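(* (i) Let $2\beta>\alpha>-1$. Then $$I_{\beta+1}=\sum_{n=0}^\infty\binom{\alpha-\beta+n-1}{n}\ell_n^{(\alpha)}$$ with convergence in $L^1(\mathbb R_+)$. In particular, for $\alpha>2$, $I_\alpha=\sum_{n=0}^\infty\ell_n^{(\alpha)}$ in $L^1(\mathbb R_+)$. (ii) For every $a>0$, $$e_a=\sum_{n=0}^\infty\frac{(a-\frac12)^n}{(a+\frac12)^{n+1}}\mathscr L_n^{(0)}$$ with convergence in $L^1(\mathbb R_+)$, where $e_a(t)=e^{-at}$.
   Context: $I_s(t):=\frac{1}{\Gamma(s)}e^{-t}t^{s-1}$ for $t>0$, $\Re s>0$. $L_n^{(\alpha)}(t)=\sum_{k=0}^n(-1)^k\binom{n+\alpha}{n-k}\frac{t^k}{k!}$ is the generalized Laguerre polynomial, and $\ell_n^{(\alpha)}(t):=\frac{n!}{\Gamma(n+\alpha+1)}t^{\alpha}e^{-t}L_n^{(\alpha)}(t)$ for $t>0$. $\mathscr L_n^{(0)}(t):=e^{-t/2}L_n^{(0)}(t)$. For real $x$, $\binom{x}{n}=\frac{x(x-1)\cdots(x-n+1)}{n!}$ and $\binom{x}{0}=1$. *)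

(* Defs.v *)
From Stdlib Require Import Reals Lra ClassicalEpsilon Arith Factorial.
Open Scope R_scope.

Definition improper_int_pos (f : R -> R) (l : R) : Prop :=
  forall eps, eps > 0 -> exists delta M, delta > 0 /\ M > 0 /\
    forall a b, 0 < a < delta -> M < b ->
      exists pr : Riemann_integrable f a b, Rabs (RiemannInt pr - l) < eps.

Definition Gamma (s : R) : R :=
  epsilon (inhabits 0)
    (fun g => improper_int_pos (fun t => exp (- t) * Rpower t (s - 1)) g).

Definition I_ (s : R) (t : R) : R := / Gamma s * exp (- t) * Rpower t (s - 1).

Fixpoint falling (x : R) (n : nat) : R :=
  match n with
  | O => 1
  | S m => falling x m * (x - INR m)
  end.
Definition gbinom (x : R) (n : nat) : R := falling x n / INR (fact n).

Definition Laguerre (n : nat) (alpha t : R) : R :=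
  sum_f_R0 (fun k => (-1) ^ k * gbinom (INR n + alpha) (n - k)
                      * t ^ k / INR (fact k)) n.

Definition ell (n : nat) (alpha t : R) : R :=
  INR (fact n) / Gamma (INR n + alpha + 1) * Rpower t alpha * exp (- t)
  * Laguerre n alpha t.

Definition scrL0 (n : nat) (t : R) : R := exp (- t / 2) * Laguerre n 0 t.

(* Convergence in L^1(R_+) of the series sum_n g n to f, for functions continuous
   on (0,+oo): the L^1 norm of the (nonnegative, continuous) remainder,
   i.e. the supremum of its Riemann integrals over compact [a,b] in (0,oo),
   tends to 0. *)
Definition L1_series_converges (f : R -> R) (g : nat -> R -> R) : Prop :=
  forall eps, eps > 0 -> exists N : nat, forall n : nat, (N <= n)%nat ->
    forall a b, 0 < a -> a <= b ->
      exists pr : Riemann_integrable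
                    (fun t => Rabs (f t - sum_f_R0 (fun k => g k t) n)) a b,
        RiemannInt pr <= eps.

(* Main.v *)
Require Import Defs.
From Stdlib Require Import Reals Factorial Lra Lia FunctionalExtensionality ClassicalEpsilon.
From Coquelicot Require Import Coquelicot.
Open Scope R_scope.

(** Both expansions are orthogonal expansions in Laguerre polynomials.

    (i) Dividing by the weight [w = t^alpha e^-t], the series is the expansion of
    [t^(beta-alpha)] in the polynomials [L_n^(alpha)], orthogonal for [w].  As [w] has
    finite mass, Cauchy-Schwarz bounds the L1 norm of the remainder by its norm in
    [L2(w)], so only Parseval's identity is needed.  By Vandermonde's identity for the
    coefficients it is Gauss's evaluation of [2F1(a,a;c;1)] with [a = alpha - beta],
    [c = alpha + 1].  The contiguous relation [c -> c + 1] preserves the relative defect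
    in Parseval's identity, and as [c] tends to infinity this defect tends to 0 by
    log-convexity of Gamma, already when only the constant term is kept.

    (ii) Parseval's identity is a geometric series, which gives convergence in L2.
    Moreover [L_n^(0)] is the second difference of [L_n^(2)], so its second moment,
    hence the L1 norm of [scrL0 n], grows polynomially in [n] and the series converges
    absolutely in L1. *)

(** * Improper integrals over the half-line *)

(** Continuity is bundled with the limit, so that integrability on every compact subinterval is
    automatic and the total function [RInt] can replace Riemann integrability witnesses. *)
Definition is_Int_pos (f : R -> R) (l : R) : Prop :=
  (forall t, 0 < t -> continuous f t) /\
  forall eps, 0 < eps -> exists d M, 0 < d /\ 0 < M /\
    forall a b, 0 < a < d -> M < b -> Rabs (RInt f a b - l) < eps.

Lemma ex_RInt_pos (f : R -> R) (a b : R) :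
  (forall t, 0 < t -> continuous f t) -> 0 < a -> 0 < b -> ex_RInt f a b.
Proof.
  intros Hf Ha Hb. apply (ex_RInt_continuous (V := R_CompleteNormedModule)).
  intros z [Hz _]. apply Hf. apply Rlt_le_trans with (2 := Hz).
  now apply Rmin_glb_lt.
Qed.

Lemma continuous_ext_pos (f g : R -> R) (t : R) :
  (forall t, 0 < t -> f t = g t) -> 0 < t -> continuous f t -> continuous g t.
Proof.
  intros E Ht. apply continuous_ext_loc.
  exists (mkposreal t Ht). intros y Hy. apply E.
  apply Rabs_lt_between in Hy. unfold minus, plus, opp in Hy; simpl in Hy. lra.
Qed.

Lemma is_Int_pos_ext (f g : R -> R) (l : R) :
  (forall t, 0 < t -> f t = g t) -> is_Int_pos f l -> is_Int_pos g l.
Proof.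
  intros E [Hc Hl]; split.
  - intros t Ht. now apply continuous_ext_pos with f; auto.
  - intros eps He. destruct (Hl eps He) as (d & M & Hd & HM & H).
    exists d, M; repeat split; auto. intros a b Ha Hb.
    rewrite <- (RInt_ext f g a b); [now apply H|].
    intros x [Hx _]. apply E. apply Rlt_trans with (2 := Hx).
    apply Rmin_glb_lt; lra.
Qed.

Lemma is_Int_pos_plus (f g : R -> R) (l m : R) :
  is_Int_pos f l -> is_Int_pos g m -> is_Int_pos (fun t => f t + g t) (l + m).
Proof.
  intros [Hf Lf] [Hg Lg]; split.
  - intros t Ht. apply (continuous_plus (V := R_NormedModule) f g t); auto.
  - intros eps He.
    destruct (Lf (eps / 2)) as (d & M & Hd & HM & H); [lra|].
    destruct (Lg (eps / 2)) as (d' & M' & Hd' & HM' & H'); [lra|].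
    exists (Rmin d d'), (Rmax M M'); repeat split.
    + now apply Rmin_glb_lt.
    + apply Rlt_le_trans with M; [auto|apply Rmax_l].
    + intros a b [Ha1 Ha2] Hb.
      pose proof (Rmin_l d d'). pose proof (Rmin_r d d').
      pose proof (Rmax_l M M'). pose proof (Rmax_r M M').
      specialize (H a b ltac:(lra) ltac:(lra)).
      specialize (H' a b ltac:(lra) ltac:(lra)).
      pose proof (RInt_plus (V := R_CompleteNormedModule) f g a b
        (ex_RInt_pos f a b Hf ltac:(lra) ltac:(lra))
        (ex_RInt_pos g a b Hg ltac:(lra) ltac:(lra))) as E.
      unfold plus in E; simpl in E. rewrite E.
      apply Rabs_def2 in H. apply Rabs_def2 in H'. apply Rabs_def1; lra.
Qed.

Lemma is_Int_pos_scal (f : R -> R) (c l : R) :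
  is_Int_pos f l -> is_Int_pos (fun t => c * f t) (c * l).
Proof.
  intros [Hf Lf]; split.
  - intros t Ht. apply (continuous_scal_r (V := R_NormedModule) c f t); auto.
  - intros eps He. pose proof (Rabs_pos c) as Hc0.
    destruct (Lf (eps / (Rabs c + 1))) as (d & M & Hd & HM & H);
      [apply Rdiv_lt_0_compat; lra|].
    exists d, M; repeat split; auto. intros a b Ha Hb.
    pose proof (RInt_scal (V := R_CompleteNormedModule) f a b c
      (ex_RInt_pos f a b Hf ltac:(lra) ltac:(lra))) as E.
    unfold scal in E; simpl in E; unfold mult in E; simpl in E. rewrite E.
    rewrite <- Rmult_minus_distr_l, Rabs_mult.
    specialize (H a b Ha Hb). apply Rle_lt_trans with (Rabs c * (eps / (Rabs c + 1))).
    + apply Rmult_le_compat_l; lra.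
    + apply Rlt_le_trans with ((Rabs c + 1) * (eps / (Rabs c + 1))).
      * apply Rmult_lt_compat_r; [apply Rdiv_lt_0_compat; lra|lra].
      * right; field; lra.
Qed.

Lemma is_Int_pos_sum (f : nat -> R -> R) (l : nat -> R) (n : nat) :
  (forall k, (k <= n)%nat -> is_Int_pos (f k) (l k)) ->
  is_Int_pos (fun t => sum_f_R0 (fun k => f k t) n) (sum_f_R0 l n).
Proof.
  induction n as [|n IH]; intros H.
  - apply (H 0%nat). lia.
  - simpl. apply is_Int_pos_plus; [apply IH|]; auto.
Qed.

Lemma is_Int_pos_unique (f : R -> R) (l m : R) :
  is_Int_pos f l -> is_Int_pos f m -> l = m.
Proof.
  intros [_ L] [_ M]. destruct (Req_dec l m) as [|Hne]; auto.
  assert (He : 0 < Rabs (l - m) / 2).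
  { pose proof (Rabs_pos_lt (l - m)). lra. }
  destruct (L _ He) as (d & B & Hd & HB & H).
  destruct (M _ He) as (d' & B' & Hd' & HB' & H').
  pose proof (Rmin_l d d'). pose proof (Rmin_r d d').
  pose proof (Rmin_glb_lt d d' 0 Hd Hd').
  specialize (H (Rmin d d' / 2) (B + B' + 1) ltac:(lra) ltac:(lra)).
  specialize (H' (Rmin d d' / 2) (B + B' + 1) ltac:(lra) ltac:(lra)).
  rewrite Rabs_minus_sym in H.
  pose proof (Rabs_triang (l - RInt f (Rmin d d' / 2) (B + B' + 1))
    (RInt f (Rmin d d' / 2) (B + B' + 1) - m)) as T.
  replace (l - RInt f (Rmin d d' / 2) (B + B' + 1) +
    (RInt f (Rmin d d' / 2) (B + B' + 1) - m)) with (l - m) in T by ring.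
  lra.
Qed.

Lemma RInt_mono_interval (f : R -> R) (a b a' b' : R) :
  (forall t, 0 < t -> continuous f t) -> (forall t, 0 < t -> 0 <= f t) ->
  0 < a' -> a' <= a -> a <= b -> b <= b' -> RInt f a b <= RInt f a' b'.
Proof.
  intros Hc Hp Ha' Ha Hab Hb.
  assert (X : forall x y, 0 < x -> 0 < y -> ex_RInt f x y)
    by (intros; now apply ex_RInt_pos).
  pose proof (RInt_Chasles (V := R_CompleteNormedModule) f a' a b'
    (X a' a ltac:(lra) ltac:(lra)) (X a b' ltac:(lra) ltac:(lra))) as E1.
  pose proof (RInt_Chasles (V := R_CompleteNormedModule) f a b b'
    (X a b ltac:(lra) ltac:(lra)) (X b b' ltac:(lra) ltac:(lra))) as E2.
  unfold plus in E1, E2; simpl in E1, E2.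
  assert (0 <= RInt f a' a)
    by (apply RInt_ge_0; [lra|apply X; lra|intros; apply Hp; lra]).
  assert (0 <= RInt f b b')
    by (apply RInt_ge_0; [lra|apply X; lra|intros; apply Hp; lra]).
  lra.
Qed.

Lemma RInt_le_Int_pos (f : R -> R) (l a b : R) :
  is_Int_pos f l -> (forall t, 0 < t -> 0 <= f t) ->
  0 < a -> a <= b -> RInt f a b <= l.
Proof.
  intros [Hc Hl] Hp Ha Hab. apply Rnot_lt_le; intros Hlt.
  destruct (Hl (RInt f a b - l)) as (d & M & Hd & HM & H); [lra|].
  set (a' := Rmin a (d / 2)). set (b' := Rmax b (M + 1)).
  assert (0 < a') by (apply Rmin_glb_lt; lra).
  assert (a' <= a) by apply Rmin_l. assert (a' <= d / 2) by apply Rmin_r.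
  assert (b <= b') by apply Rmax_l. assert (M + 1 <= b') by apply Rmax_r.
  specialize (H a' b' ltac:(lra) ltac:(lra)). apply Rabs_def2 in H.
  pose proof (RInt_mono_interval f a b a' b' Hc Hp) as Hm.
  specialize (Hm ltac:(lra) ltac:(lra) ltac:(lra) ltac:(lra)). lra.
Qed.

Lemma is_Int_pos_ge_0 (f : R -> R) (l : R) :
  is_Int_pos f l -> (forall t, 0 < t -> 0 <= f t) -> 0 <= l.
Proof.
  intros Hf Hp. apply Rle_trans with (RInt f 1 1).
  - rewrite RInt_point. unfold zero; simpl; lra.
  - apply RInt_le_Int_pos; auto; lra.
Qed.

Lemma is_Int_pos_le (f g : R -> R) (l m : R) :
  is_Int_pos f l -> is_Int_pos g m -> (forall t, 0 < t -> f t <= g t) -> l <= m.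
Proof.
  intros Hf Hg H.
  assert (X := is_Int_pos_plus _ _ _ _ Hg (is_Int_pos_scal _ (-1) _ Hf)).
  apply is_Int_pos_ge_0 in X; [lra|]. intros t Ht. specialize (H t Ht). lra.
Qed.

(** For a nonnegative integrand the compact integrals grow with the interval, so their supremum is
    the improper integral. *)
Lemma ex_Int_pos_bounded (f : R -> R) (B : R) :
  (forall t, 0 < t -> continuous f t) -> (forall t, 0 < t -> 0 <= f t) ->
  (forall a b, 0 < a -> a <= b -> RInt f a b <= B) -> exists l, is_Int_pos f l.
Proof.
  intros Hc Hp HB.
  destruct (completeness (fun y => exists a b, 0 < a <= b /\ y = RInt f a b))
    as [l [Hub Hlub]].
  - exists B. intros y (a & b & [Ha Hb] & ->). now apply HB.
  - exists (RInt f 1 1), 1, 1. split; [lra|easy].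
  - exists l; split; auto. intros eps He.
    assert (exists a b, 0 < a <= b /\ l - eps < RInt f a b) as (a & b & [Ha Hab] & Hl).
    { apply Classical_Prop.NNPP; intros N.
      assert (l <= l - eps); [|lra]. apply Hlub. intros y (a & b & Hab & ->).
      apply Rnot_lt_le; intros Hlt. apply N. exists a, b. now split. }
    exists a, b; repeat split; [lra|lra|]. intros a' b' Ha' Hb'.
    assert (RInt f a b <= RInt f a' b') by (apply RInt_mono_interval; auto; lra).
    assert (RInt f a' b' <= l) by (apply Hub; exists a', b'; split; [lra|easy]).
    apply Rabs_def1; lra.
Qed.

Lemma ex_Int_pos_dominated (f g : R -> R) (m : R) :
  (forall t, 0 < t -> continuous f t) -> (forall t, 0 < t -> 0 <= f t <= g t) ->
  is_Int_pos g m -> exists l, is_Int_pos f l.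
Proof.
  intros Hc H Hg. apply ex_Int_pos_bounded with m; auto.
  - intros t Ht; now apply H.
  - intros a b Ha Hab. apply Rle_trans with (RInt g a b).
    + apply RInt_le; auto; [apply ex_RInt_pos; auto; lra| |].
      * apply ex_RInt_pos; [apply Hg|lra|lra].
      * intros x Hx; apply H; lra.
    + apply RInt_le_Int_pos; auto. intros t Ht; specialize (H t Ht); lra.
Qed.

(** [A] and [B] are the limits of the antiderivative at 0 and at infinity. All explicit integrals
    below come from this form of the fundamental theorem. *)
Lemma is_Int_pos_derive (F f : R -> R) (A B : R) :
  (forall t, 0 < t -> is_derive F t (f t)) ->
  (forall t, 0 < t -> continuous f t) ->
  (forall eps, 0 < eps -> exists d, 0 < d /\
     forall t, 0 < t < d -> Rabs (F t - A) < eps) ->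
  (forall eps, 0 < eps -> exists M, 0 < M /\
     forall t, M < t -> Rabs (F t - B) < eps) ->
  is_Int_pos f (B - A).
Proof.
  intros HF Hc HA HB; split; auto. intros eps He.
  destruct (HA (eps / 2)) as (d & Hd & H1); [lra|].
  destruct (HB (eps / 2)) as (M & HM & H2); [lra|].
  exists d, M; repeat split; auto. intros a b Ha Hb.
  assert (Hpos : forall x, Rmin a b <= x -> 0 < x).
  { intros x Hx. apply Rlt_le_trans with (2 := Hx). apply Rmin_glb_lt; lra. }
  rewrite (is_RInt_unique f a b (minus (F b) (F a))).
  - unfold minus, plus, opp; simpl.
    specialize (H1 a Ha). specialize (H2 b Hb).
    apply Rabs_def2 in H1. apply Rabs_def2 in H2. apply Rabs_def1; lra.
  - apply (is_RInt_derive (V := R_CompleteNormedModule) F f); intros x [Hx _]; auto.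
Qed.

(** * The Gamma function *)

Lemma ln_le_minus_1 (x : R) : 0 < x -> ln x <= x - 1.
Proof. intros Hx. pose proof (exp_ineq1_le (ln x)) as H. rewrite exp_ln in H; lra. Qed.

Lemma exp_le_mono (x y : R) : x <= y -> exp x <= exp y.
Proof. intros [H| ->]; [left; now apply exp_increasing|now right]. Qed.

Lemma exp_le_1 (x : R) : x <= 0 -> exp x <= 1.
Proof. intros H. rewrite <- exp_0. now apply exp_le_mono. Qed.

Lemma Rpower_pos (x y : R) : 0 < Rpower x y.
Proof. apply exp_pos. Qed.

Lemma continuous_exp_Rpower (c s t : R) :
  0 < t -> continuous (fun t => exp (- (c * t)) * Rpower t s) t.
Proof.
  intros Ht. apply (ex_derive_continuous (V := R_NormedModule)).
  unfold Rpower. auto_derive. exact Ht.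
Qed.

Lemma exp_ln_lim_0 (s eps : R) : 0 < s -> 0 < eps ->
  exists d, 0 < d /\ forall t, 0 < t < d -> exp (s * ln t) < eps.
Proof.
  intros Hs He. exists (exp (ln eps / s)); split; [apply exp_pos|].
  intros t [Ht Hd]. rewrite <- (exp_ln eps He). apply exp_increasing.
  apply ln_increasing in Hd; auto. rewrite ln_exp in Hd.
  apply (Rmult_lt_compat_l s) in Hd; auto.
  replace (s * (ln eps / s)) with (ln eps) in Hd by (field; lra). exact Hd.
Qed.

Lemma exp_Rpower_lim_infty (c s eps : R) : 0 < c -> 0 < s -> 0 < eps ->
  exists M, 0 < M /\ forall t, M < t -> exp (- (c * t)) * Rpower t s < eps.
Proof.
  (* The tangent bound [ln (k * t) <= k * t - 1], with [s * k = c / 2], gives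
     [s * ln t <= c * t / 2 + C]; half of the exponential decay is left over. *)
  intros Hc Hs He. set (k := c / (2 * s)).
  assert (Hk : 0 < k) by (apply Rdiv_lt_0_compat; lra).
  set (C := - (s * ln k)).
  exists (Rabs (2 * (C - ln eps) / c) + 1); split.
  { pose proof (Rabs_pos (2 * (C - ln eps) / c)). lra. }
  intros t Ht. pose proof (Rle_abs (2 * (C - ln eps) / c)).
  pose proof (Rabs_pos (2 * (C - ln eps) / c)).
  unfold Rpower. rewrite <- exp_plus, <- (exp_ln eps He). apply exp_increasing.
  assert (H1 : ln t <= k * t - 1 - ln k).
  { pose proof (ln_le_minus_1 (k * t)) as H1.
    rewrite ln_mult in H1 by lra. specialize (H1 ltac:(nra)). lra. }
  assert (H2 : s * ln t <= c * t / 2 + C).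
  { apply Rle_trans with (s * (k * t - 1 - ln k)); [apply Rmult_le_compat_l; lra|].
    replace (s * (k * t - 1 - ln k)) with (c * t / 2 - s + C)
      by (unfold C, k; field; lra). lra. }
  assert (H3 : 2 * (C - ln eps) < c * t).
  { replace (2 * (C - ln eps)) with (c * (2 * (C - ln eps) / c)) by (field; lra).
    apply Rmult_lt_compat_l; lra. }
  lra.
Qed.

(** The integrand is the derivative of [exp (- (c * t)) * Rpower t s], which vanishes at both ends.
    This is the integration by parts behind the functional equation of Gamma. *)
Lemma is_Int_pos_exp_Rpower_derive (c s : R) : 0 < c -> 0 < s ->
  is_Int_pos (fun t => s * (exp (- (c * t)) * Rpower t (s - 1))
                       + - c * (exp (- (c * t)) * Rpower t s)) 0.
Proof.
  intros Hc Hs. replace 0 with (0 - 0) by ring.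
  apply is_Int_pos_derive with (F := fun t => exp (- (c * t)) * Rpower t s).
  - intros t Ht. unfold Rpower. auto_derive; [exact Ht|].
    replace ((s - 1) * ln t) with (s * ln t + - ln t) by ring.
    rewrite exp_plus, (exp_Ropp (ln t)), (exp_ln t) by easy. field; lra.
  - intros t Ht. apply (continuous_plus (V := R_NormedModule));
      apply (continuous_scal_r (V := R_NormedModule));
      now apply continuous_exp_Rpower.
  - intros eps He. destruct (exp_ln_lim_0 s eps Hs He) as (d & Hd & H).
    exists d; split; auto. intros t Ht. rewrite Rminus_0_r, Rabs_pos_eq.
    + apply Rle_lt_trans with (2 := H t Ht). unfold Rpower.
      rewrite <- (Rmult_1_l (exp (s * ln t))) at 2.
      apply Rmult_le_compat_r; [left; apply exp_pos|].
      apply exp_le_1. nra.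
    + apply Rmult_le_pos; left; [apply exp_pos|apply Rpower_pos].
  - intros eps He. destruct (exp_Rpower_lim_infty c s eps Hc Hs He) as (M & HM & H).
    exists M; split; auto. intros t Ht. rewrite Rminus_0_r, Rabs_pos_eq; auto.
    apply Rmult_le_pos; left; [apply exp_pos|apply Rpower_pos].
Qed.

Lemma is_Int_pos_exp_Rpower_succ (c s l : R) : 0 < c -> 0 < s ->
  is_Int_pos (fun t => exp (- (c * t)) * Rpower t (s - 1)) l ->
  is_Int_pos (fun t => exp (- (c * t)) * Rpower t s) (s / c * l).
Proof.
  intros Hc Hs Hl.
  pose proof (is_Int_pos_plus _ _ _ _
    (is_Int_pos_scal _ (- / c) _ (is_Int_pos_exp_Rpower_derive c s Hc Hs))
    (is_Int_pos_scal _ (s / c) _ Hl)) as H.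
  replace (s / c * l) with (- / c * 0 + s / c * l) by ring.
  apply is_Int_pos_ext with (2 := H). intros t Ht; simpl. field; lra.
Qed.

(** The integrand is the derivative of (t/(1+t))^s, which rises from 0 to 1. It equals s
    t^(s-1)/(1+t)^(s+1), an integrable majorant for the Gamma integrand; for s = 1 it is
    1/(1+t)^2. *)
Lemma is_Int_pos_beta_kernel (s : R) : 0 < s ->
  is_Int_pos (fun t => exp (s * (ln t - ln (1 + t))) * (s / (t * (1 + t)))) 1.
Proof.
  intros Hs.
  match goal with |- is_Int_pos ?f _ =>
    enough (H : is_Int_pos f (1 - 0)) by (now rewrite Rminus_0_r in H) end.
  apply is_Int_pos_derive with (F := fun t => exp (s * (ln t - ln (1 + t)))).
  - intros t Ht. auto_derive; [lra|]. unfold Rdiv, Rminus. field. lra.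
  - intros t Ht. apply (ex_derive_continuous (V := R_NormedModule)).
    auto_derive. repeat split; try lra. nra.
  - intros eps He. destruct (exp_ln_lim_0 s eps Hs He) as (d & Hd & H).
    exists d; split; auto. intros t Ht.
    rewrite Rminus_0_r, Rabs_pos_eq by (left; apply exp_pos).
    apply Rle_lt_trans with (2 := H t Ht). apply exp_le_mono.
    apply Rmult_le_compat_l; [lra|].
    pose proof (ln_le 1 (1 + t)) as L. rewrite ln_1 in L. lra.
  (* Here 1 - (t/(1+t))^s <= s (ln (1+t) - ln t) <= s/t, which is below [eps] beyond [s / eps]. *)
  - intros eps He. exists (s / eps); split; [apply Rdiv_lt_0_compat; lra|].
    intros t Ht. pose proof (Rdiv_lt_0_compat s eps Hs He).
    assert (Ht0 : 0 < t) by lra.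
    assert (Hst : s / t < eps).
    { apply Rmult_lt_reg_r with t; [lra|].
      apply (Rmult_lt_compat_l eps) in Ht; [|lra].
      replace (eps * (s / eps)) with s in Ht by (field; lra).
      replace (s / t * t) with s by (field; lra). lra. }
    assert (ln t <= ln (1 + t)) by (apply ln_le; lra).
    assert (ln (1 + t) - ln t <= / t).
    { rewrite <- ln_div by lra. pose proof (ln_le_minus_1 ((1 + t) / t)) as L.
      replace ((1 + t) / t - 1) with (/ t) in L by (field; lra).
      apply L. apply Rdiv_lt_0_compat; lra. }
    pose proof (exp_ineq1_le (s * (ln t - ln (1 + t)))).
    assert (exp (s * (ln t - ln (1 + t))) <= 1).
    { apply exp_le_1.
      assert (s * ln t <= s * ln (1 + t)) by (apply Rmult_le_compat_l; lra). lra. }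
    apply Rabs_def1; [lra|].
    assert (s * (ln (1 + t) - ln t) <= s / t) by (apply Rmult_le_compat_l; lra).
    lra.
Qed.

(** Domination by the beta kernel: with K = s + 1, the tangent bound for ln at (1+t)/K gives (1+t)^K
    e^-t <= K^K, and [C] is K^K divided by the factor s of the kernel. *)
Lemma ex_Int_pos_Gamma (s : R) : 0 < s ->
  exists l, is_Int_pos (fun t => exp (- t) * Rpower t (s - 1)) l.
Proof.
  intros Hs. set (K := s + 1). set (C := exp (K * ln K) / s).
  eapply ex_Int_pos_dominated with
    (g := fun t => C * (exp (s * (ln t - ln (1 + t))) * (s / (t * (1 + t))))).
  - intros t Ht. apply (ex_derive_continuous (V := R_NormedModule)).
    unfold Rpower. auto_derive. exact Ht.
  - intros t Ht; split.
    { apply Rmult_le_pos; left; [apply exp_pos|apply Rpower_pos]. }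
    replace (s / (t * (1 + t))) with (s * (exp (- ln t) * exp (- ln (1 + t)))).
    2: { rewrite !exp_Ropp, !exp_ln by lra. field; lra. }
    unfold C, Rpower.
    replace (exp (K * ln K) / s *
      (exp (s * (ln t - ln (1 + t))) * (s * (exp (- ln t) * exp (- ln (1 + t))))))
    with (exp (K * ln K) * (exp (s * (ln t - ln (1 + t))) *
           (exp (- ln t) * exp (- ln (1 + t))))) by (field; lra).
    rewrite <- !exp_plus. apply exp_le_mono.
    assert (H : K * ln (1 + t) <= t + K * ln K).
    { pose proof (ln_le_minus_1 ((1 + t) / K)) as L. unfold K in L at 1.
      specialize (L ltac:(apply Rdiv_lt_0_compat; lra)).
      rewrite ln_div in L by (unfold K; lra).
      apply (Rmult_le_compat_l K) in L; [|unfold K; lra].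
      replace (K * ((1 + t) / K - 1)) with (1 + t - K) in L
        by (field; unfold K; lra).
      unfold K in *. lra. }
    unfold K in *. lra.
  - apply is_Int_pos_scal, is_Int_pos_beta_kernel, Hs.
Qed.

(** [Gamma] is a choice by [epsilon], so nothing is known about it until some value of the integral
    is shown to exist. *)
Lemma Gamma_is_Int_pos (s : R) : 0 < s ->
  is_Int_pos (fun t => exp (- t) * Rpower t (s - 1)) (Gamma s).
Proof.
  intros Hs. destruct (ex_Int_pos_Gamma s Hs) as (l & Hc & Hl).
  assert (E : improper_int_pos (fun t => exp (- t) * Rpower t (s - 1)) (Gamma s)).
  { unfold Gamma. apply epsilon_spec. exists l. intros eps He.
    destruct (Hl eps He) as (d & M & Hd & HM & H).
    exists d, M; repeat split; auto. intros a b Ha Hb.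
    assert (X := ex_RInt_pos _ a b Hc ltac:(lra) ltac:(lra)).
    exists (ex_RInt_Reals_0 _ _ _ X). rewrite <- RInt_Reals. now apply H. }
  split; auto. intros eps He. destruct (E eps He) as (d & M & Hd & HM & H).
  exists d, M; repeat split; auto. intros a b Ha Hb.
  destruct (H a b Ha Hb) as [pr Hpr]. now rewrite (RInt_Reals _ _ _ pr).
Qed.

Lemma Gamma_is_Int_pos' (s : R) : -1 < s ->
  is_Int_pos (fun t => exp (- t) * Rpower t s) (Gamma (s + 1)).
Proof.
  intros Hs. apply is_Int_pos_ext with (2 := Gamma_is_Int_pos (s + 1) ltac:(lra)).
  intros t Ht. do 2 f_equal. ring.
Qed.

Lemma Gamma_succ (s : R) : 0 < s -> Gamma (s + 1) = s * Gamma s.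
Proof.
  intros Hs. apply is_Int_pos_unique with (1 := Gamma_is_Int_pos' s ltac:(lra)).
  replace (s * Gamma s) with (s / 1 * Gamma s) by field.
  apply is_Int_pos_ext with (fun t => exp (- (1 * t)) * Rpower t s).
  { intros t _. now rewrite Rmult_1_l. }
  apply is_Int_pos_exp_Rpower_succ; try lra.
  apply is_Int_pos_ext with (2 := Gamma_is_Int_pos s Hs).
  intros t _. now rewrite Rmult_1_l.
Qed.

Lemma Gamma_pos (s : R) : 0 < s -> 0 < Gamma s.
Proof.
  intros Hs. pose proof (Gamma_is_Int_pos s Hs) as H.
  apply Rlt_le_trans with (RInt (fun t => exp (- t) * Rpower t (s - 1)) 1 2).
  - apply RInt_gt_0; [lra| |].
    + intros x _. apply Rmult_lt_0_compat; [apply exp_pos|apply Rpower_pos].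
    + intros x Hx. apply H. lra.
  - apply RInt_le_Int_pos; auto; try lra. intros t _.
    apply Rmult_le_pos; left; [apply exp_pos|apply Rpower_pos].
Qed.

(** * Log-convexity of Gamma and its ratios at large arguments *)

Lemma exp_convex (p a b : R) : 0 <= p <= 1 ->
  exp (p * a + (1 - p) * b) <= p * exp a + (1 - p) * exp b.
Proof.
  intros Hp. set (m := p * a + (1 - p) * b).
  assert (H : forall x, exp m * (1 + (x - m)) <= exp x).
  { intros x. replace x with (m + (x - m)) at 2 by ring. rewrite exp_plus.
    apply Rmult_le_compat_l; [left; apply exp_pos|apply exp_ineq1_le]. }
  pose proof (Rmult_le_compat_l p _ _ ltac:(lra) (H a)) as Ha.
  pose proof (Rmult_le_compat_l (1 - p) _ _ ltac:(lra) (H b)) as Hb.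
  replace (exp m) with (p * (exp m * (1 + (a - m)))
    + (1 - p) * (exp m * (1 + (b - m)))); [lra|].
  unfold m. ring.
Qed.

(* Hölder, via the pointwise Young inequality between the normalised kernels. *)
Lemma ln_Gamma_convex (p u v : R) : 0 <= p <= 1 -> 0 < u -> 0 < v ->
  ln (Gamma (p * u + (1 - p) * v)) <= p * ln (Gamma u) + (1 - p) * ln (Gamma v).
Proof.
  intros Hp Hu Hv. set (w := p * u + (1 - p) * v).
  assert (Hw : 0 < w).
  { unfold w. destruct (Req_dec p 0) as [-> |]; [lra|].
    assert (0 < p * u) by (apply Rmult_lt_0_compat; lra).
    assert (0 <= (1 - p) * v) by (apply Rmult_le_pos; lra). lra. }
  pose proof (Gamma_pos u Hu) as Gu. pose proof (Gamma_pos v Hv) as Gv.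
  pose proof (Gamma_pos w Hw) as Gw.
  set (m := p * ln (Gamma u) + (1 - p) * ln (Gamma v)).
  assert (H : / exp m * Gamma w <= p / Gamma u * Gamma u + (1 - p) / Gamma v * Gamma v).
  { apply is_Int_pos_le with
      (1 := is_Int_pos_scal _ (/ exp m) _ (Gamma_is_Int_pos w Hw))
      (2 := is_Int_pos_plus _ _ _ _
        (is_Int_pos_scal _ (p / Gamma u) _ (Gamma_is_Int_pos u Hu))
        (is_Int_pos_scal _ ((1 - p) / Gamma v) _ (Gamma_is_Int_pos v Hv))).
    intros t Ht. simpl.
    assert (E : forall c x, 0 < c -> / c * (exp (- t) * Rpower t (x - 1))
              = exp (- ln c + (- t + (x - 1) * ln t))).
    { intros c x Hc. unfold Rpower. rewrite !exp_plus, (exp_Ropp (ln c)), exp_ln; auto. }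
    unfold Rdiv. rewrite !Rmult_assoc, (E _ u), (E _ v), (E _ w) by (auto; apply exp_pos).
    rewrite ln_exp. eapply Rle_trans; [|apply exp_convex, Hp].
    right. f_equal. unfold m, w. ring. }
  rewrite <- (ln_exp m). apply ln_le; auto.
  apply Rmult_le_reg_l with (/ exp m); [apply Rinv_0_lt_compat, exp_pos|].
  rewrite Rinv_l by (apply Rgt_not_eq, exp_pos).
  replace 1 with (p / Gamma u * Gamma u + (1 - p) / Gamma v * Gamma v); auto.
  field; lra.
Qed.

(** Log-convexity at y, written as a convex combination of y - 1 and y + p; the functional equation
    then trades Gamma(y - 1) for Gamma(y)/(y - 1). *)
Lemma ln_Gamma_add_ge (y p : R) : 1 < y -> 0 <= p ->
  ln (Gamma y) + p * ln (y - 1) <= ln (Gamma (y + p)).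
Proof.
  intros Hy Hp.
  pose proof (ln_Gamma_convex (p / (1 + p)) (y - 1) (y + p)) as H.
  replace (p / (1 + p) * (y - 1) + (1 - p / (1 + p)) * (y + p)) with y in H
    by (field; lra).
  assert (Hp1 : 0 <= p / (1 + p) <= 1).
  { split; [apply Rmult_le_pos; [lra|left; apply Rinv_0_lt_compat; lra]|].
    apply Rmult_le_reg_r with (1 + p); [lra|].
    replace (p / (1 + p) * (1 + p)) with p by (field; lra). lra. }
  specialize (H Hp1 ltac:(lra) ltac:(lra)).
  assert (E : ln (Gamma y) = ln (y - 1) + ln (Gamma (y - 1))).
  { rewrite <- ln_mult by (try apply Gamma_pos; lra).
    rewrite <- Gamma_succ by lra. do 2 f_equal. ring. }
  apply (Rmult_le_compat_l (1 + p)) in H; [|lra].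
  replace ((1 + p) * (p / (1 + p) * ln (Gamma (y - 1))
    + (1 - p / (1 + p)) * ln (Gamma (y + p))))
    with (p * ln (Gamma (y - 1)) + ln (Gamma (y + p))) in H by (field; lra).
  assert (p * ln (Gamma y) = p * (ln (y - 1) + ln (Gamma (y - 1)))) by now rewrite E.
  lra.
Qed.

(** Log-convexity at y + p, between y and y + p + 1, followed by the functional equation at the
    upper point. *)
Lemma ln_Gamma_add_le (y p : R) : 0 < y -> 0 <= p ->
  ln (Gamma (y + p)) <= ln (Gamma y) + p * ln (y + p).
Proof.
  intros Hy Hp.
  pose proof (ln_Gamma_convex (/ (1 + p)) y (y + p + 1)) as H.
  replace (/ (1 + p) * y + (1 - / (1 + p)) * (y + p + 1)) with (y + p) in H
    by (field; lra).
  assert (Hp1 : 0 <= / (1 + p) <= 1).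
  { split; [left; apply Rinv_0_lt_compat; lra|].
    rewrite <- Rinv_1. apply Rinv_le_contravar; lra. }
  specialize (H Hp1 ltac:(lra) ltac:(lra)).
  rewrite Gamma_succ in H by lra.
  rewrite (ln_mult (y + p)) in H by (try apply Gamma_pos; lra).
  apply (Rmult_le_compat_l (1 + p)) in H; [|lra].
  replace ((1 + p) * (/ (1 + p) * ln (Gamma y)
    + (1 - / (1 + p)) * (ln (y + p) + ln (Gamma (y + p)))))
    with (ln (Gamma y) + p * (ln (y + p) + ln (Gamma (y + p)))) in H by (field; lra).
  lra.
Qed.

(** The two preceding bounds, at x and at x + p, bound the logarithm of the ratio below by p ln(x-1)
    - p ln(x+2p). The tangent bounds for ln and exp make this rational. *)
Lemma Gamma_ratio_lower_nonneg (x p : R) : 1 < x -> 0 <= p ->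
  1 - p * (2 * p + 1) / (x - 1)
  <= Gamma (x + p) ^ 2 / (Gamma x * Gamma (x + 2 * p)).
Proof.
  intros Hx Hp.
  pose proof (Gamma_pos x ltac:(lra)) as G0.
  pose proof (Gamma_pos (x + p) ltac:(lra)) as G1.
  pose proof (Gamma_pos (x + 2 * p) ltac:(lra)) as G2.
  pose proof (ln_Gamma_add_ge x p Hx Hp) as H1.
  pose proof (ln_Gamma_add_le (x + p) p ltac:(lra) Hp) as H2.
  replace (x + p + p) with (x + 2 * p) in H2 by ring.
  replace (Gamma (x + p) ^ 2 / (Gamma x * Gamma (x + 2 * p)))
    with (exp (2 * ln (Gamma (x + p)) - ln (Gamma x) - ln (Gamma (x + 2 * p)))).
  2: { replace (2 * ln (Gamma (x + p)) - ln (Gamma x) - ln (Gamma (x + 2 * p)))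
         with (ln (Gamma (x + p)) + ln (Gamma (x + p)) + - ln (Gamma x)
               + - ln (Gamma (x + 2 * p))) by ring.
       rewrite !exp_plus, !exp_Ropp, !exp_ln by auto. field; lra. }
  eapply Rle_trans; [|apply exp_ineq1_le].
  pose proof (ln_le_minus_1 ((x + 2 * p) / (x - 1))) as L.
  specialize (L ltac:(apply Rdiv_lt_0_compat; lra)).
  rewrite ln_div in L by lra.
  replace ((x + 2 * p) / (x - 1) - 1) with ((2 * p + 1) / (x - 1)) in L by (field; lra).
  apply (Rmult_le_compat_l p) in L; auto.
  replace (p * ((2 * p + 1) / (x - 1))) with (p * (2 * p + 1) / (x - 1)) in L
    by (field; lra).
  lra.
Qed.

Lemma Gamma_ratio_lim (c p eps : R) : 0 < eps ->
  exists m : nat, forall x, c + INR m <= x ->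
    1 - eps <= Gamma (x + p) ^ 2 / (Gamma x * Gamma (x + 2 * p)).
Proof.
  intros He. set (q := Rabs p). assert (Hq : 0 <= q) by apply Rabs_pos.
  set (B := q * (2 * q + 1) / eps + 1).
  assert (HB1 : 0 <= B - 1).
  { unfold B. replace (q * (2 * q + 1) / eps + 1 - 1) with (q * (2 * q + 1) / eps) by ring.
    apply Rmult_le_pos; [nra|left; now apply Rinv_0_lt_compat]. }
  assert (K : forall y, B < y -> 1 - eps <= 1 - q * (2 * q + 1) / (y - 1)).
  { intros y Hy. assert (q * (2 * q + 1) / (y - 1) <= eps); [|lra].
    apply Rmult_le_reg_r with (y - 1); [lra|].
    replace (q * (2 * q + 1) / (y - 1) * (y - 1)) with (eps * (B - 1))
      by (unfold B; field; lra).
    apply Rmult_le_compat_l; lra. }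
  (* The margin [2 * q] puts both [x] and [x + 2 * p] beyond [B], whatever the sign of [p]. *)
  destruct (INR_unbounded (B + 2 * q - c)) as [m Hm].
  exists m. intros x Hx.
  destruct (Rle_lt_dec 0 p) as [Hp|Hp].
  - unfold q in *. rewrite Rabs_pos_eq in * by auto.
    eapply Rle_trans; [apply (K x); lra|]. apply Gamma_ratio_lower_nonneg; lra.
  (* The ratio is symmetric under exchange of its outer arguments, so a negative [p] is treated from
     the base point [x + 2 * p] with step [- p]. *)
  - assert (Eq : q = - p) by (unfold q; now apply Rabs_left).
    eapply Rle_trans; [apply (K (x + 2 * p)); lra|].
    eapply Rle_trans; [apply (Gamma_ratio_lower_nonneg (x + 2 * p) q); lra|].
    right. rewrite Eq. replace (x + 2 * p + - p) with (x + p) by ring.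
    replace (x + 2 * p + 2 * - p) with x by ring. f_equal. ring.
Qed.

(** * Binomial coefficients and Laguerre moments *)

Lemma falling_shift (x : R) (n : nat) : falling x (S n) = x * falling (x - 1) n.
Proof.
  induction n as [|n IH]; [simpl; ring|].
  change (falling x (S (S n))) with (falling x (S n) * (x - INR (S n))).
  rewrite IH, S_INR. simpl. ring.
Qed.

Lemma falling_nat_0 (j n : nat) : (j < n)%nat -> falling (INR j) n = 0.
Proof.
  induction n as [|n IH]; intros H; [lia|]. simpl.
  destruct (Nat.eq_dec j n) as [-> |]; [ring|]. rewrite IH by lia. ring.
Qed.

Lemma fact_S_INR (n : nat) : INR (fact (S n)) = (INR n + 1) * INR (fact n).
Proof. rewrite fact_simpl, mult_INR, S_INR. ring. Qed.

Lemma falling_opp_1 (n : nat) : falling (-1) n = (-1) ^ n * INR (fact n).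
Proof.
  induction n as [|n IH]; [simpl; ring|].
  rewrite fact_S_INR. simpl. rewrite IH. ring.
Qed.

Lemma gbinom_0_r (x : R) : gbinom x 0 = 1.
Proof. unfold gbinom; simpl; field. Qed.

Lemma gbinom_succ (x : R) (n : nat) :
  (INR n + 1) * gbinom x (S n) = gbinom x n * (x - INR n).
Proof.
  unfold gbinom. rewrite fact_S_INR. simpl. pose proof (INR_fact_neq_0 n).
  pose proof (pos_INR n). field. lra.
Qed.

Lemma gbinom_diag (n : nat) : gbinom (INR n) n = 1.
Proof.
  enough (H : falling (INR n) n = INR (fact n)).
  { unfold gbinom. rewrite H. field. apply INR_fact_neq_0. }
  induction n as [|n IH]; [easy|].
  rewrite falling_shift, fact_S_INR, S_INR.
  replace (INR n + 1 - 1) with (INR n) by ring. now rewrite IH.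
Qed.

Lemma gbinom_rising_succ (a : R) (n : nat) :
  (INR n + 1) * gbinom (a + INR (S n) - 1) (S n)
  = (a + INR n) * gbinom (a + INR n - 1) n.
Proof.
  unfold gbinom. rewrite falling_shift, fact_S_INR, S_INR.
  replace (a + (INR n + 1) - 1) with (a + INR n) by ring.
  pose proof (INR_fact_neq_0 n). pose proof (pos_INR n). field. lra.
Qed.

Lemma gbinom_pascal (x : R) (n : nat) :
  gbinom (x + 1) (S n) = gbinom x (S n) + gbinom x n.
Proof.
  unfold gbinom. rewrite (falling_shift (x + 1)), fact_S_INR.
  replace (x + 1 - 1) with x by ring. simpl.
  pose proof (INR_fact_neq_0 n). pose proof (pos_INR n). field. lra.
Qed.

Lemma sum_f_R0_shift (f : nat -> R) (n : nat) :
  sum_f_R0 f (S n) = f 0%nat + sum_f_R0 (fun k => f (S k)) n.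
Proof. rewrite decomp_sum by lia. easy. Qed.

(** Induction after multiplying by n + 1 and splitting it as (n + 1 - k) + k. Each half is absorbed
    into one binomial, and the resulting factors x - (n - k) and y - k add up to x + y - n. *)
Lemma gbinom_vandermonde (x y : R) (n : nat) :
  sum_f_R0 (fun k => gbinom x (n - k) * gbinom y k) n = gbinom (x + y) n.
Proof.
  induction n as [|n IH].
  { simpl. rewrite !gbinom_0_r. ring. }
  apply Rmult_eq_reg_l with (INR n + 1); [|pose proof (pos_INR n); lra].
  rewrite gbinom_succ, <- IH, scal_sum.
  transitivity (sum_f_R0 (fun k => (INR (S n) - INR k)
                             * gbinom x (S n - k) * gbinom y k) (S n)
    + sum_f_R0 (fun k => INR k * gbinom x (S n - k) * gbinom y k) (S n)).
  { rewrite <- sum_plus. apply sum_eq. intros k _. rewrite S_INR. ring. }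
  (* The last term of the first sum and the first term of the second vanish; reindexing the second
     sum aligns the two. *)
  rewrite tech5, (sum_f_R0_shift (fun k => INR k * _ * _)), Rminus_diag.
  simpl INR at 3. rewrite !Rmult_0_l, Rplus_0_r, Rplus_0_l, <- sum_plus.
  rewrite Rmult_comm, scal_sum. apply sum_eq. intros k Hk.
  replace (S n - k)%nat with (S (n - k)) by lia.
  replace (S n - S k)%nat with (n - k)%nat by lia.
  pose proof (gbinom_succ x (n - k)) as E1. pose proof (gbinom_succ y k) as E2.
  rewrite minus_INR in E1 by lia. rewrite !S_INR.
  transitivity ((INR n - INR k + 1) * gbinom x (S (n - k)) * gbinom y k
    + gbinom x (n - k) * ((INR k + 1) * gbinom y (S k))); [ring|].
  rewrite E1, E2. ring.
Qed.

(** The rising product (b+1)...(b+k) is written with falling factors so that, divided by k!, it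
    becomes a signed [gbinom (- b - 1) k], ready for Vandermonde's identity. *)
Lemma Gamma_add_nat (b : R) (k : nat) : -1 < b ->
  Gamma (b + INR k + 1) = (-1) ^ k * falling (- b - 1) k * Gamma (b + 1).
Proof.
  intros Hb. induction k as [|k IH].
  - simpl. replace (b + 0 + 1) with (b + 1) by ring. ring.
  - rewrite S_INR. replace (b + (INR k + 1) + 1) with (b + INR k + 1 + 1) by ring.
    pose proof (pos_INR k). rewrite Gamma_succ, IH by lra. simpl. ring.
Qed.

(** Termwise integration: the sign from the Gamma values cancels the sign in [Laguerre], and the
    remaining sum is Vandermonde's for n + alpha and -b - 1. Orthogonality and the coefficients of
    the power are both instances. *)
Lemma is_Int_pos_Laguerre_moment (alpha b : R) (n : nat) : -1 < b ->
  is_Int_pos (fun t => exp (- t) * Rpower t b * Laguerre n alpha t)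
    (Gamma (b + 1) * gbinom (alpha - b + INR n - 1) n).
Proof.
  intros Hb.
  replace (alpha - b + INR n - 1) with (INR n + alpha + (- b - 1)) by ring.
  rewrite <- gbinom_vandermonde, scal_sum.
  rewrite (sum_eq _ (fun k => (-1) ^ k * gbinom (INR n + alpha) (n - k)
    / INR (fact k) * Gamma (b + INR k + 1))).
  2: { intros k _. rewrite Gamma_add_nat by auto. unfold gbinom at 2.
       replace ((-1) ^ k * gbinom (INR n + alpha) (n - k) / INR (fact k)
         * ((-1) ^ k * falling (- b - 1) k * Gamma (b + 1)))
       with (((-1) ^ k * (-1) ^ k) * (gbinom (INR n + alpha) (n - k) / INR (fact k)
         * (falling (- b - 1) k * Gamma (b + 1)))) by (unfold Rdiv; ring).
       rewrite <- Rpow_mult_distr. replace (-1 * -1) with 1 by ring.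
       rewrite pow1. unfold Rdiv; ring. }
  apply is_Int_pos_ext with (fun t => sum_f_R0 (fun k =>
    (-1) ^ k * gbinom (INR n + alpha) (n - k) / INR (fact k)
    * (exp (- t) * Rpower t (b + INR k))) n).
  - intros t Ht. unfold Laguerre. rewrite scal_sum. apply sum_eq. intros k _.
    rewrite Rpower_plus, Rpower_pow by auto. unfold Rdiv; ring.
  - apply (is_Int_pos_sum (fun k t => _)). intros k _. apply is_Int_pos_scal.
    apply Gamma_is_Int_pos'. pose proof (pos_INR k). lra.
Qed.

(** Only the factor of index [m] is expanded; each of its monomials gives a moment of the other
    factor, with exponent [alpha + INR k]. *)
Lemma is_Int_pos_Laguerre_mul (alpha : R) (m n : nat) : -1 < alpha ->
  is_Int_pos (fun t => exp (- t) * Rpower t alpha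
                       * (Laguerre m alpha t * Laguerre n alpha t))
    (sum_f_R0 (fun k => (-1) ^ k * gbinom (INR m + alpha) (m - k) / INR (fact k)
       * (Gamma (alpha + INR k + 1) * gbinom (INR n - INR k - 1) n)) m).
Proof.
  intros Ha.
  apply is_Int_pos_ext with (fun t => sum_f_R0 (fun k =>
    (-1) ^ k * gbinom (INR m + alpha) (m - k) / INR (fact k)
    * (exp (- t) * Rpower t (alpha + INR k) * Laguerre n alpha t)) m).
  - intros t Ht. unfold Laguerre at 2.
    rewrite (Rmult_comm (sum_f_R0 _ _)), <- Rmult_assoc.
    rewrite scal_sum. apply sum_eq. intros k _.
    rewrite Rpower_plus, Rpower_pow by auto. unfold Rdiv; ring.
  - apply (is_Int_pos_sum (fun k t => _)). intros k _. apply is_Int_pos_scal.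
    replace (INR n - INR k - 1) with (alpha - (alpha + INR k) + INR n - 1) by ring.
    apply is_Int_pos_Laguerre_moment. pose proof (pos_INR k). lra.
Qed.

(** The upper entry is a natural number below [n], so the falling product meets zero. This makes the
    Laguerre polynomial of index n orthogonal to every power below n. *)
Lemma gbinom_moment_0 (k n : nat) : (k < n)%nat -> gbinom (INR n - INR k - 1) n = 0.
Proof.
  intros H. unfold gbinom.
  replace (INR n - INR k - 1) with (INR (n - k - 1)).
  - rewrite falling_nat_0 by lia. field. apply INR_fact_neq_0.
  - rewrite !minus_INR by lia. simpl. ring.
Qed.

Lemma is_Int_pos_Laguerre_orth (alpha : R) (m n : nat) : -1 < alpha -> (m < n)%nat ->
  is_Int_pos (fun t => exp (- t) * Rpower t alpha
                       * (Laguerre m alpha t * Laguerre n alpha t)) 0.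
Proof.
  intros Ha Hmn.
  assert (H := is_Int_pos_Laguerre_mul alpha m n Ha).
  rewrite sum_eq_R0 in H; auto.
  intros k Hk. rewrite gbinom_moment_0 by lia. ring.
Qed.

Lemma is_Int_pos_Laguerre_norm (alpha : R) (n : nat) : -1 < alpha ->
  is_Int_pos (fun t => exp (- t) * Rpower t alpha
                       * (Laguerre n alpha t * Laguerre n alpha t))
    (Gamma (INR n + alpha + 1) / INR (fact n)).
Proof.
  intros Ha.
  replace (Gamma (INR n + alpha + 1) / INR (fact n)) with
    (sum_f_R0 (fun k => (-1) ^ k * gbinom (INR n + alpha) (n - k) / INR (fact k)
       * (Gamma (alpha + INR k + 1) * gbinom (INR n - INR k - 1) n)) n);
    [now apply is_Int_pos_Laguerre_mul|].
  assert (L : forall f : nat -> R, (forall k, (k < n)%nat -> f k = 0) ->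
              sum_f_R0 f n = f n).
  { intros f Hf. destruct n as [|n']; [easy|]. rewrite tech5, sum_eq_R0; [ring|].
    intros k Hk. apply Hf. lia. }
  (* Only the leading monomial k = n contributes; its two signs cancel. *)
  rewrite L by (intros k Hk; rewrite gbinom_moment_0 by lia; ring).
  replace (INR n - INR n - 1) with (-1) by ring.
  rewrite Nat.sub_diag, gbinom_0_r. unfold gbinom. rewrite falling_opp_1.
  replace (alpha + INR n + 1) with (INR n + alpha + 1) by ring.
  assert (E : (-1) ^ n * (-1) ^ n = 1).
  { rewrite <- Rpow_mult_distr. replace (-1 * -1) with 1 by ring. apply pow1. }
  pose proof (INR_fact_neq_0 n).
  transitivity ((-1) ^ n * (-1) ^ n * (Gamma (INR n + alpha + 1) / INR (fact n)));
    [field; auto|rewrite E; ring].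
Qed.

(** Pascal's rule coefficient by coefficient; the terms of degree n + 1 agree on both sides because
    [gbinom _ 0] is 1. *)
Lemma Laguerre_pascal (alpha t : R) (n : nat) :
  Laguerre (S n) alpha t = Laguerre (S n) (alpha + 1) t - Laguerre n (alpha + 1) t.
Proof.
  unfold Laguerre. rewrite !tech5, !Nat.sub_diag, !gbinom_0_r.
  match goal with |- ?a + ?x = ?b + _ - ?c =>
    enough (H : a + c = b) by (rewrite <- H; ring) end.
  rewrite <- sum_plus. apply sum_eq. intros k Hk.
  replace (S n - k)%nat with (S (n - k)) by lia. rewrite S_INR.
  replace (INR n + 1 + (alpha + 1)) with (INR n + 1 + alpha + 1) by ring.
  rewrite gbinom_pascal.
  replace (INR n + (alpha + 1)) with (INR n + 1 + alpha) by ring.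
  unfold Rdiv; ring.
Qed.

Lemma Laguerre_0 (alpha t : R) : Laguerre 0 alpha t = 1.
Proof. unfold Laguerre; simpl. rewrite gbinom_0_r. field. Qed.

(** * Orthogonal expansions *)

(** Parseval's identity for a finite sum, with [h] the squared norms and [b] the unnormalised
    coefficients. Components are removed one at a time, so only integrals of products of two
    functions are ever needed. *)
Lemma is_Int_pos_orth_remainder (w f : R -> R) (phi : nat -> R -> R)
    (b h : nat -> R) (F : R) :
  (forall n, h n <> 0) ->
  (forall m n, (m < n)%nat -> is_Int_pos (fun t => w t * (phi m t * phi n t)) 0) ->
  (forall n, is_Int_pos (fun t => w t * (phi n t * phi n t)) (h n)) ->
  (forall n, is_Int_pos (fun t => w t * (f t * phi n t)) (b n)) ->
  is_Int_pos (fun t => w t * (f t * f t)) F ->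
  forall N, is_Int_pos
    (fun t => w t * (f t - sum_f_R0 (fun k => b k / h k * phi k t) N) ^ 2)
    (F - sum_f_R0 (fun k => b k ^ 2 / h k) N).
Proof.
  intros Hh Horth Hnorm Hb HF.
  assert (step : forall (r : R -> R) (G : R) (N : nat),
    is_Int_pos (fun t => w t * (r t * r t)) G ->
    is_Int_pos (fun t => w t * (r t * phi N t)) (b N) ->
    is_Int_pos (fun t => w t * (r t - b N / h N * phi N t) ^ 2) (G - b N ^ 2 / h N)).
  { intros r G N HG Hr.
    assert (H := is_Int_pos_plus _ _ _ _ HG (is_Int_pos_plus _ _ _ _
      (is_Int_pos_scal _ (- 2 * (b N / h N)) _ Hr)
      (is_Int_pos_scal _ ((b N / h N) ^ 2) _ (Hnorm N)))).
    match type of H with is_Int_pos _ ?v => replace (G - b N ^ 2 / h N) with v end.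
    2: { specialize (Hh N). field; auto. }
    apply is_Int_pos_ext with (2 := H). intros t _. simpl. ring. }
  assert (step' : forall (r : R -> R) (N m : nat), (N < m)%nat ->
    is_Int_pos (fun t => w t * (r t * phi m t)) (b m) ->
    is_Int_pos (fun t => w t * ((r t - b N / h N * phi N t) * phi m t)) (b m)).
  { intros r N m Hm Hr.
    assert (H := is_Int_pos_plus _ _ _ _ Hr
      (is_Int_pos_scal _ (- (b N / h N)) _ (Horth N m Hm))).
    rewrite Rmult_0_r, Rplus_0_r in H.
    apply is_Int_pos_ext with (2 := H). intros t _. simpl. ring. }
  intros N.
  (* The induction also carries that the remainder has the same coefficients as [f] against all
     later [phi m]. *)
  enough (H : is_Int_pos (fun t => w t *
      (f t - sum_f_R0 (fun k => b k / h k * phi k t) N) ^ 2)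
      (F - sum_f_R0 (fun k => b k ^ 2 / h k) N) /\
    forall m, (N < m)%nat -> is_Int_pos (fun t => w t *
      ((f t - sum_f_R0 (fun k => b k / h k * phi k t) N) * phi m t)) (b m))
    by apply H.
  induction N as [|N [IH1 IH2]]; split.
  - now apply step.
  - intros m Hm. now apply step'.
  - simpl sum_f_R0. rewrite Rminus_plus_distr.
    eapply is_Int_pos_ext; [|apply step; [|apply IH2; lia]].
    + intros t _. simpl. ring.
    + apply is_Int_pos_ext with (2 := IH1). intros t _; simpl; ring.
  - intros m Hm. simpl sum_f_R0.
    eapply is_Int_pos_ext; [|apply (step' (fun t =>
      f t - sum_f_R0 (fun k => b k / h k * phi k t) N) (S N) m Hm), (IH2 m); lia].
    intros t _. simpl. ring.
Qed.

(** * Gauss's sum and Parseval's identity for powers *)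

(** With a = alpha - beta and c = alpha + 1 this is (a)_n^2 / (n! Gamma(c+n)), the n-th term of
    2F1(a,a;c;1)/Gamma(c). *)
Definition gauss_term (alpha beta : R) (n : nat) : R :=
  gbinom (alpha - beta + INR n - 1) n ^ 2 * INR (fact n) / Gamma (INR n + alpha + 1).

(** Gauss's value Gamma(c-2a)/Gamma(c-a)^2 of 2F1(a,a;c;1)/Gamma(c). *)
Definition gauss_value (alpha beta : R) : R :=
  Gamma (2 * beta - alpha + 1) / Gamma (beta + 1) ^ 2.

Definition gauss_error (alpha beta : R) (N : nat) : R :=
  gauss_value alpha beta - sum_f_R0 (gauss_term alpha beta) N.

Lemma gauss_term_ge_0 (alpha beta : R) (n : nat) : -1 < alpha ->
  0 <= gauss_term alpha beta n.
Proof.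
  intros Ha. pose proof (pos_INR n).
  apply Rmult_le_pos.
  - apply Rmult_le_pos; [apply pow2_ge_0|apply pos_INR].
  - left. apply Rinv_0_lt_compat, Gamma_pos. lra.
Qed.

Lemma gauss_value_pos (alpha beta : R) : -1 < alpha -> -1 < 2 * beta - alpha ->
  0 < gauss_value alpha beta.
Proof.
  intros Ha Hb. apply Rdiv_lt_0_compat; [|apply pow_lt]; apply Gamma_pos; lra.
Qed.

Lemma gauss_term_succ (alpha beta : R) (n : nat) : -1 < alpha ->
  (INR n + 1) * gauss_term alpha beta (S n)
  = (alpha - beta + INR n) ^ 2 / (INR n + alpha + 1) * gauss_term alpha beta n.
Proof.
  intros Ha. unfold gauss_term. pose proof (pos_INR n) as Hn.
  pose proof (Gamma_pos (INR n + alpha + 1) ltac:(lra)) as G.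
  pose proof (gbinom_rising_succ (alpha - beta) n) as E.
  rewrite fact_S_INR.
  replace (Gamma (INR (S n) + alpha + 1))
    with ((INR n + alpha + 1) * Gamma (INR n + alpha + 1)).
  2: { rewrite <- Gamma_succ by lra. f_equal. rewrite S_INR. ring. }
  transitivity (((INR n + 1) * gbinom (alpha - beta + INR (S n) - 1) (S n)) ^ 2
    * INR (fact n) / ((INR n + alpha + 1) * Gamma (INR n + alpha + 1)));
    [field; lra|].
  rewrite E. field; lra.
Qed.

(** Raising [alpha] and [beta] together keeps a and raises c by one. *)
Lemma gauss_term_shift (alpha beta : R) (n : nat) : -1 < alpha ->
  gauss_term (alpha + 1) (beta + 1) n = gauss_term alpha beta n / (INR n + alpha + 1).
Proof.
  intros Ha. unfold gauss_term. pose proof (pos_INR n) as Hn.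
  replace (alpha + 1 - (beta + 1)) with (alpha - beta) by ring.
  replace (INR n + (alpha + 1) + 1) with (INR n + alpha + 1 + 1) by ring.
  pose proof (Gamma_pos (INR n + alpha + 1) ltac:(lra)) as G.
  rewrite Gamma_succ by lra. field; lra.
Qed.

Lemma gauss_value_shift (alpha beta : R) : -1 < alpha -> -1 < 2 * beta - alpha ->
  (beta + 1) ^ 2 * gauss_value (alpha + 1) (beta + 1)
  = (2 * beta - alpha + 1) * gauss_value alpha beta.
Proof.
  intros Ha Hb. unfold gauss_value.
  replace (2 * (beta + 1) - (alpha + 1) + 1) with (2 * beta - alpha + 1 + 1) by ring.
  pose proof (Gamma_pos (beta + 1) ltac:(lra)) as G.
  rewrite (Gamma_succ (2 * beta - alpha + 1)), (Gamma_succ (beta + 1)) by lra. field; lra.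
Qed.

(* Summed form of the contiguous relation for 2F1(a,a;c;1) with a = alpha - beta
   and c = alpha + 1; the boundary term is what the telescoping leaves. *)
Lemma gauss_error_shift (alpha beta : R) (N : nat) :
  -1 < alpha -> -1 < 2 * beta - alpha ->
  (2 * beta - alpha + 1) * gauss_error alpha beta N
  = (beta + 1) ^ 2 * gauss_error (alpha + 1) (beta + 1) N
    + (INR N + 1) * gauss_term alpha beta (S N).
Proof.
  intros Ha Hb. unfold gauss_error.
  rewrite !Rmult_minus_distr_l, gauss_value_shift by auto.
  enough (H : (2 * beta - alpha + 1) * sum_f_R0 (gauss_term alpha beta) N
    + (INR N + 1) * gauss_term alpha beta (S N)
    = (beta + 1) ^ 2 * sum_f_R0 (gauss_term (alpha + 1) (beta + 1)) N) by lra.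
  induction N as [|N IH].
  - rewrite gauss_term_succ by auto. simpl sum_f_R0.
    rewrite gauss_term_shift by auto. simpl INR. field. lra.
  - rewrite (gauss_term_succ _ _ (S N)) by auto. rewrite !tech5.
    rewrite !Rmult_plus_distr_l, <- IH, (gauss_term_shift _ _ (S N)) by auto.
    rewrite S_INR. pose proof (pos_INR N). field. lra.
Qed.

Definition wt (alpha t : R) : R := exp (- t) * Rpower t alpha.

Lemma wt_pos (alpha t : R) : 0 < wt alpha t.
Proof. apply Rmult_lt_0_compat; [apply exp_pos|apply Rpower_pos]. Qed.

(** The weight times t^(beta-alpha) is e^-t t^beta, so the coefficients are Laguerre moments with
    exponent beta, and the squared norm of the power is Gamma(2 beta - alpha + 1). *)
Lemma is_Int_pos_power_remainder (alpha beta : R) (N : nat) :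
  -1 < alpha -> -1 < 2 * beta - alpha ->
  is_Int_pos (fun t => wt alpha t * (Rpower t (beta - alpha) - sum_f_R0 (fun k =>
      Gamma (beta + 1) * gbinom (alpha - beta + INR k - 1) k
      / (Gamma (INR k + alpha + 1) / INR (fact k)) * Laguerre k alpha t) N) ^ 2)
    (Gamma (beta + 1) ^ 2 * gauss_error alpha beta N).
Proof.
  intros Ha Hb.
  pose proof (Gamma_pos (beta + 1) ltac:(lra)) as G.
  assert (Gn : forall n, 0 < Gamma (INR n + alpha + 1)).
  { intros n. apply Gamma_pos. pose proof (pos_INR n). lra. }
  replace (Gamma (beta + 1) ^ 2 * gauss_error alpha beta N)
    with (Gamma (2 * beta - alpha + 1) - sum_f_R0 (fun k =>
      (Gamma (beta + 1) * gbinom (alpha - beta + INR k - 1) k) ^ 2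
      / (Gamma (INR k + alpha + 1) / INR (fact k))) N).
  2: { unfold gauss_error. rewrite Rmult_minus_distr_l, scal_sum. f_equal.
       - unfold gauss_value. field. lra.
       - apply sum_eq. intros k _. unfold gauss_term. specialize (Gn k).
         pose proof (INR_fact_neq_0 k). field. lra. }
  apply (is_Int_pos_orth_remainder (wt alpha) (fun t => Rpower t (beta - alpha))
    (fun k => Laguerre k alpha)
    (fun k => Gamma (beta + 1) * gbinom (alpha - beta + INR k - 1) k)
    (fun k => Gamma (INR k + alpha + 1) / INR (fact k))).
  - intros n. specialize (Gn n). pose proof (INR_fact_lt_0 n).
    apply Rgt_not_eq, Rdiv_lt_0_compat; lra.
  - intros m n Hmn. now apply is_Int_pos_Laguerre_orth.
  - intros n. now apply is_Int_pos_Laguerre_norm.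
  - intros n.
    apply is_Int_pos_ext with (2 := is_Int_pos_Laguerre_moment alpha beta n ltac:(lra)).
    intros t Ht. unfold wt. replace beta with (alpha + (beta - alpha)) at 1 by ring.
    rewrite Rpower_plus. ring.
  - apply is_Int_pos_ext with (2 := Gamma_is_Int_pos' (2 * beta - alpha) ltac:(lra)).
    intros t Ht. unfold wt.
    replace (2 * beta - alpha) with (alpha + ((beta - alpha) + (beta - alpha))) by ring.
    rewrite !Rpower_plus. ring.
Qed.

(** Bessel's inequality: up to a positive factor the error is the integral of a nonnegative
    function. *)
Lemma gauss_error_ge_0 (alpha beta : R) (N : nat) :
  -1 < alpha -> -1 < 2 * beta - alpha -> 0 <= gauss_error alpha beta N.
Proof.
  intros Ha Hb. pose proof (Gamma_pos (beta + 1) ltac:(lra)) as G.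
  assert (H := is_Int_pos_ge_0 _ _ (is_Int_pos_power_remainder alpha beta N Ha Hb)).
  apply Rmult_le_reg_l with (Gamma (beta + 1) ^ 2); [now apply pow_lt|].
  rewrite Rmult_0_r. apply H. intros t Ht.
  apply Rmult_le_pos; [left; apply wt_pos|apply pow2_ge_0].
Qed.

Lemma gauss_error_decr (alpha beta : R) (M N : nat) : -1 < alpha -> (M <= N)%nat ->
  gauss_error alpha beta N <= gauss_error alpha beta M.
Proof.
  intros Ha. induction 1 as [|N _ IH]; [lra|].
  apply Rle_trans with (2 := IH). unfold gauss_error. rewrite tech5.
  pose proof (gauss_term_ge_0 alpha beta (S N) Ha). lra.
Qed.

(** Otherwise the terms would eventually exceed those of a harmonic series, whose partial sums
    outgrow [B] like a logarithm. This disposes of the boundary term of the contiguous relation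
    along some indices, without a decay rate. *)
Lemma bounded_sum_frequently_small (u : nat -> R) (B eps : R) (N0 : nat) :
  (forall n, 0 <= u n) -> (forall N, sum_f_R0 u N <= B) -> 0 < eps ->
  exists N, (N0 <= N)%nat /\ (INR N + 1) * u (S N) <= eps.
Proof.
  intros Hu HB He. apply Classical_Prop.NNPP. intros Hn.
  assert (Hbig : forall N, (N0 <= N)%nat -> eps < (INR N + 1) * u (S N)).
  { intros N HN. apply Rnot_le_lt. intros H. apply Hn. exists N. now split. }
  assert (Hlog : forall N, (N0 <= N)%nat ->
    eps * (ln (INR N + 1) - ln (INR N0 + 1)) <= sum_f_R0 u N).
  { intros N HN. induction HN as [|N HN IH].
    - rewrite Rminus_diag, Rmult_0_r. now apply cond_pos_sum.
    - rewrite tech5, S_INR. specialize (Hbig N HN). pose proof (pos_INR N).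
      assert (L : ln (INR N + 1 + 1) - ln (INR N + 1) <= / (INR N + 1)).
      { rewrite <- ln_div by lra.
        pose proof (ln_le_minus_1 ((INR N + 1 + 1) / (INR N + 1))) as L.
        replace ((INR N + 1 + 1) / (INR N + 1) - 1) with (/ (INR N + 1)) in L
          by (field; lra).
        apply L, Rdiv_lt_0_compat; lra. }
      apply (Rmult_le_compat_l eps) in L; [|lra].
      assert (eps * / (INR N + 1) <= u (S N)).
      { apply Rmult_le_reg_r with (INR N + 1); [lra|].
        rewrite Rmult_assoc, Rinv_l by lra. lra. }
      lra. }
  destruct (INR_unbounded (exp (B / eps + ln (INR N0 + 1) + 1))) as [N HN].
  set (K := Nat.max N N0).
  assert (HK : INR N <= INR K) by (apply le_INR; unfold K; lia).
  specialize (Hlog K ltac:(unfold K; lia)). specialize (HB K).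
  assert (L : B / eps + ln (INR N0 + 1) + 1 <= ln (INR K + 1)).
  { rewrite <- (ln_exp (B / eps + ln (INR N0 + 1) + 1)) .
    apply ln_le; [apply exp_pos|lra]. }
  assert (L2 : eps * (B / eps + 1) <= eps * (ln (INR K + 1) - ln (INR N0 + 1)))
    by (apply Rmult_le_compat_l; lra).
  replace (eps * (B / eps + 1)) with (B + eps) in L2 by (field; lra).
  lra.
Qed.

(** Dividing the contiguous relation by the corresponding relation between the values leaves the
    relative defect unchanged except for the boundary term. That term costs half of [eta]; as [eta]
    is arbitrary, [rho] does not deteriorate under iteration. *)
Lemma gauss_error_shift_bound (alpha beta rho : R) :
  -1 < alpha -> -1 < 2 * beta - alpha ->
  (forall eta, 0 < eta -> exists N, gauss_error (alpha + 1) (beta + 1) N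
     <= (rho + eta) * gauss_value (alpha + 1) (beta + 1)) ->
  forall eta, 0 < eta -> exists N,
    gauss_error alpha beta N <= (rho + eta) * gauss_value alpha beta.
Proof.
  intros Ha Hb H eta He.
  destruct (H (eta / 2)) as [N0 HN0]; [lra|].
  pose proof (gauss_value_pos alpha beta Ha Hb) as HV.
  destruct (bounded_sum_frequently_small (gauss_term alpha beta)
    (gauss_value alpha beta)
    ((2 * beta - alpha + 1) * gauss_value alpha beta * (eta / 2)) N0)
    as (N & HN & Hsmall).
  - intros n. now apply gauss_term_ge_0.
  - intros N. pose proof (gauss_error_ge_0 alpha beta N Ha Hb) as G.
    unfold gauss_error in G. lra.
  - apply Rmult_lt_0_compat; [apply Rmult_lt_0_compat|]; lra.
  - exists N.
    apply Rmult_le_reg_l with (2 * beta - alpha + 1); [lra|].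
    rewrite gauss_error_shift by auto.
    pose proof (gauss_error_decr (alpha + 1) (beta + 1) N0 N ltac:(lra) HN).
    assert (X : (beta + 1) ^ 2 * gauss_error (alpha + 1) (beta + 1) N
      <= (beta + 1) ^ 2 * ((rho + eta / 2) * gauss_value (alpha + 1) (beta + 1))).
    { apply Rmult_le_compat_l; [apply pow2_ge_0|lra]. }
    replace ((beta + 1) ^ 2 * ((rho + eta / 2) * gauss_value (alpha + 1) (beta + 1)))
      with ((rho + eta / 2) * ((beta + 1) ^ 2 * gauss_value (alpha + 1) (beta + 1)))
      in X by ring.
    rewrite gauss_value_shift in X by auto. lra.
Qed.

Lemma gauss_error_shift_bound_iter (m : nat) (alpha beta rho : R) :
  -1 < alpha -> -1 < 2 * beta - alpha ->
  (forall eta, 0 < eta -> exists N,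
     gauss_error (alpha + INR m) (beta + INR m) N
     <= (rho + eta) * gauss_value (alpha + INR m) (beta + INR m)) ->
  forall eta, 0 < eta -> exists N,
    gauss_error alpha beta N <= (rho + eta) * gauss_value alpha beta.
Proof.
  revert alpha beta. induction m as [|m IH]; intros alpha beta Ha Hb H.
  - simpl in H. now rewrite !Rplus_0_r in H.
  - apply gauss_error_shift_bound; auto. apply IH; try lra.
    rewrite S_INR in H.
    replace (alpha + 1 + INR m) with (alpha + (INR m + 1)) by ring.
    replace (beta + 1 + INR m) with (beta + (INR m + 1)) by ring. exact H.
Qed.

(* Gauss's summation theorem, in the form of Parseval's identity for t^(beta-alpha). *)
Lemma gauss_error_lim (alpha beta eps : R) :
  -1 < alpha -> -1 < 2 * beta - alpha -> 0 < eps ->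
  exists N0, forall N, (N0 <= N)%nat -> gauss_error alpha beta N <= eps.
Proof.
  intros Ha Hb He. pose proof (gauss_value_pos alpha beta Ha Hb) as HV.
  (* Half of the admissible relative error; the other half is spent as [eta]. *)
  set (rho := eps / gauss_value alpha beta / 2).
  assert (Hrho : 0 < rho).
  { pose proof (Rdiv_lt_0_compat eps _ He HV). unfold rho. lra. }
  destruct (Gamma_ratio_lim (alpha + 1) (beta - alpha) rho Hrho) as [m Hm].
  specialize (Hm (alpha + INR m + 1) ltac:(lra)).
  destruct (gauss_error_shift_bound_iter m alpha beta rho Ha Hb) with (eta := rho)
    as [N0 HN0]; auto.
  (* At the shifted parameters the Gamma ratio is the quotient of the term of index 0 by the full
     value, so the constant term alone suffices. *)
  - intros eta Heta. exists 0%nat. pose proof (pos_INR m) as Hm0.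
    set (al := alpha + INR m) in *. set (be := beta + INR m).
    assert (Hal : -1 < al) by (unfold al; lra).
    assert (Hbe : -1 < 2 * be - al) by (unfold be, al; lra).
    pose proof (gauss_value_pos al be Hal Hbe).
    apply Rle_trans with (rho * gauss_value al be).
    + replace (al + 1 + (beta - alpha)) with (be + 1) in Hm by (unfold al, be; ring).
      replace (al + 1 + 2 * (beta - alpha)) with (2 * be - al + 1) in Hm
        by (unfold al, be; ring).
      apply (Rmult_le_compat_r (gauss_value al be)) in Hm; [|lra].
      replace (Gamma (be + 1) ^ 2 / (Gamma (al + 1) * Gamma (2 * be - al + 1))
        * gauss_value al be) with (gauss_term al be 0) in Hm.
      * unfold gauss_error. simpl. lra.
      * unfold gauss_value, gauss_term. rewrite gbinom_0_r. simpl.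
        rewrite Rplus_0_l.
        pose proof (Gamma_pos (al + 1) ltac:(lra)).
        pose proof (Gamma_pos (be + 1) ltac:(lra)).
        pose proof (Gamma_pos (2 * be - al + 1) ltac:(lra)). field. lra.
    + apply Rmult_le_compat_r; lra.
  - exists N0. intros N HN.
    apply Rle_trans with (1 := gauss_error_decr alpha beta N0 N Ha HN).
    apply Rle_trans with (1 := HN0). right. unfold rho. field. lra.
Qed.

(** * Convergence in L1 *)

Lemma continuous_sum_f_R0 (f : nat -> R -> R) (n : nat) (t : R) :
  (forall k, (k <= n)%nat -> continuous (f k) t) ->
  continuous (fun t => sum_f_R0 (fun k => f k t) n) t.
Proof.
  induction n as [|n IH]; intros H; [now apply (H 0%nat)|].
  simpl. apply (continuous_plus (V := R_NormedModule)); [apply IH; auto|now apply H].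
Qed.

Lemma continuous_Rmult (f g : R -> R) (t : R) :
  continuous f t -> continuous g t -> continuous (fun t => f t * g t) t.
Proof. apply (continuous_mult (K := R_AbsRing)). Qed.

Lemma continuous_Rminus (f g : R -> R) (t : R) :
  continuous f t -> continuous g t -> continuous (fun t => f t - g t) t.
Proof. apply (continuous_minus (V := R_NormedModule)). Qed.

Lemma continuous_Laguerre (n : nat) (alpha t : R) : continuous (Laguerre n alpha) t.
Proof.
  apply (continuous_sum_f_R0 (fun k t => _)). intros k _.
  apply (ex_derive_continuous (V := R_NormedModule)). auto_derive. easy.
Qed.

Lemma continuous_wt (alpha t : R) : 0 < t -> continuous (wt alpha) t.
Proof.
  intros Ht. apply (ex_derive_continuous (V := R_NormedModule)).
  unfold wt, Rpower. auto_derive. exact Ht.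
Qed.

Lemma L1_series_converges_intro (f : R -> R) (g : nat -> R -> R) :
  (forall t, 0 < t -> continuous f t) ->
  (forall k t, 0 < t -> continuous (g k) t) ->
  (forall eps, 0 < eps -> exists N : nat, forall n, (N <= n)%nat ->
     forall a b, 0 < a -> a <= b ->
       RInt (fun t => Rabs (f t - sum_f_R0 (fun k => g k t) n)) a b <= eps) ->
  L1_series_converges f g.
Proof.
  intros Hf Hg H eps He. destruct (H eps He) as [N HN].
  exists N. intros n Hn a b Ha Hab.
  assert (X : ex_RInt (fun t => Rabs (f t - sum_f_R0 (fun k => g k t) n)) a b).
  { apply ex_RInt_pos; [|lra|lra]. intros t Ht.
    apply (continuous_Rabs_comp (fun t => f t - sum_f_R0 (fun k => g k t) n)).
    apply continuous_Rminus; [auto|].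
    apply (continuous_sum_f_R0 g). auto. }
  exists (ex_RInt_Reals_0 _ _ _ X). rewrite <- RInt_Reals. now apply HN.
Qed.

Lemma RInt_abs_le_Int_pos (u g : R -> R) (m a b : R) :
  (forall t, 0 < t -> continuous u t) -> is_Int_pos g m ->
  (forall t, 0 < t -> Rabs (u t) <= g t) -> 0 < a -> a <= b ->
  RInt (fun t => Rabs (u t)) a b <= m.
Proof.
  intros Hu Hg H Ha Hab.
  apply Rle_trans with (RInt g a b).
  - apply RInt_le; auto.
    + apply ex_RInt_pos; [|lra|lra]. intros t Ht. apply continuous_Rabs_comp; auto.
    + apply ex_RInt_pos; [apply Hg|lra|lra].
    + intros t Ht. apply H. lra.
  - apply RInt_le_Int_pos; auto. intros t Ht.
    apply Rle_trans with (2 := H t Ht). apply Rabs_pos.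
Qed.

(** Integrated, this stands in for the Cauchy-Schwarz inequality; [d] is chosen to balance the two
    terms, and may depend on the point. *)
Lemma Rabs_le_young (x d : R) : 0 < d -> Rabs x <= / 2 * (d + / d * x ^ 2).
Proof.
  intros Hd. rewrite <- (pow2_abs x). set (y := Rabs x).
  assert (H : 0 <= / d * (d - y) ^ 2).
  { apply Rmult_le_pos; [left; now apply Rinv_0_lt_compat|apply pow2_ge_0]. }
  replace (/ d * (d - y) ^ 2) with (d + / d * y ^ 2 - 2 * y) in H by (field; lra).
  lra.
Qed.

Lemma ell_wt (n : nat) (alpha t : R) :
  ell n alpha t = INR (fact n) / Gamma (INR n + alpha + 1) * (wt alpha t * Laguerre n alpha t).
Proof. unfold ell, wt. ring. Qed.

Lemma I_expansion (alpha beta : R) : -1 < alpha -> -1 < 2 * beta - alpha ->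
  L1_series_converges (I_ (beta + 1))
    (fun n t => gbinom (alpha - beta + INR n - 1) n * ell n alpha t).
Proof.
  intros Ha Hb.
  pose proof (Gamma_pos (beta + 1) ltac:(lra)) as D.
  pose proof (Gamma_pos (alpha + 1) ltac:(lra)) as G.
  assert (cI : forall t, 0 < t -> continuous (I_ (beta + 1)) t).
  { intros t Ht. apply (ex_derive_continuous (V := R_NormedModule)).
    unfold I_, Rpower. auto_derive. exact Ht. }
  assert (cg : forall k t, 0 < t -> continuous (fun t =>
    gbinom (alpha - beta + INR k - 1) k * ell k alpha t) t).
  { intros k t Ht. apply continuous_Rmult; [apply continuous_const|].
    apply continuous_ext with (fun t => INR (fact k) / Gamma (INR k + alpha + 1)
      * (wt alpha t * Laguerre k alpha t)); [intros x; now rewrite ell_wt|].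
    apply continuous_Rmult; [apply continuous_const|].
    apply continuous_Rmult; [now apply continuous_wt|apply continuous_Laguerre]. }
  apply L1_series_converges_intro; auto.
  intros eps He.
  (* With this [d] and an error of at most [eps ^ 2 / Gamma (alpha + 1)], each of the two terms of
     Young's bound contributes at most [eps / 2]. *)
  set (d := Gamma (beta + 1) * eps / Gamma (alpha + 1)).
  assert (Hd : 0 < d) by (apply Rdiv_lt_0_compat; [apply Rmult_lt_0_compat|]; lra).
  destruct (gauss_error_lim alpha beta (eps ^ 2 / Gamma (alpha + 1)) Ha Hb) as [N HN].
  { apply Rdiv_lt_0_compat; [apply pow_lt|]; lra. }
  exists N. intros n Hn a b Hpa Hab. specialize (HN n Hn).
  set (r := fun t => Rpower t (beta - alpha) - sum_f_R0 (fun k =>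
      Gamma (beta + 1) * gbinom (alpha - beta + INR k - 1) k
      / (Gamma (INR k + alpha + 1) / INR (fact k)) * Laguerre k alpha t) n).
  assert (Er : forall t, 0 < t -> I_ (beta + 1) t - sum_f_R0 (fun k =>
    gbinom (alpha - beta + INR k - 1) k * ell k alpha t) n
    = / Gamma (beta + 1) * (wt alpha t * r t)).
  { intros t Ht. unfold r. rewrite !Rmult_minus_distr_l. f_equal.
    - unfold I_, wt. replace (beta + 1 - 1) with (alpha + (beta - alpha)) by ring.
      rewrite Rpower_plus. ring.
    - rewrite <- Rmult_assoc, scal_sum. apply sum_eq. intros k _. rewrite ell_wt.
      pose proof (pos_INR k). pose proof (Gamma_pos (INR k + alpha + 1) ltac:(lra)).
      pose proof (INR_fact_neq_0 k). field. lra. }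
  assert (HI := is_Int_pos_scal _ (/ 2 * / Gamma (beta + 1)) _
    (is_Int_pos_plus _ _ _ _
      (is_Int_pos_scal _ d _ (Gamma_is_Int_pos' alpha Ha))
      (is_Int_pos_scal _ (/ d) _ (is_Int_pos_power_remainder alpha beta n Ha Hb)))).
  eapply Rle_trans; [eapply RInt_abs_le_Int_pos with (2 := HI)|]; auto.
  - intros t Ht. apply continuous_Rminus; auto.
    apply (continuous_sum_f_R0 (fun k t => _)). auto.
  - intros t Ht. cbv beta. rewrite (Er t Ht). fold (r t). fold (wt alpha t).
    rewrite Rabs_mult, (Rabs_mult (wt alpha t)).
    pose proof (Rinv_0_lt_compat _ D). pose proof (wt_pos alpha t).
    rewrite (Rabs_pos_eq (/ Gamma (beta + 1))), (Rabs_pos_eq (wt alpha t)) by lra.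
    replace (/ 2 * / Gamma (beta + 1) *
      (d * wt alpha t + / d * (wt alpha t * r t ^ 2))) with
      (/ Gamma (beta + 1) * (wt alpha t * (/ 2 * (d + / d * r t ^ 2)))) by ring.
    apply Rmult_le_compat_l; [lra|]. apply Rmult_le_compat_l; [lra|].
    now apply Rabs_le_young.
  - apply Rle_trans with (/ 2 * / Gamma (beta + 1) * (d * Gamma (alpha + 1)
      + / d * (Gamma (beta + 1) ^ 2 * (eps ^ 2 / Gamma (alpha + 1))))).
    + pose proof (Rinv_0_lt_compat _ D). pose proof (Rinv_0_lt_compat _ Hd).
      apply Rmult_le_compat_l; [lra|]. apply Rplus_le_compat_l.
      apply Rmult_le_compat_l; [lra|].
      apply Rmult_le_compat_l; [apply pow2_ge_0|lra].
    + right. unfold d. field. lra.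
Qed.

(** * Expansion of the exponentials *)

Lemma is_Int_pos_exp (c : R) : 0 < c -> is_Int_pos (fun t => exp (- (c * t))) (/ c).
Proof.
  intros Hc. replace (/ c) with (0 - (- / c)) by ring.
  pose proof (Rinv_0_lt_compat c Hc) as Hi.
  apply is_Int_pos_derive with (F := fun t => - (exp (- (c * t)) / c)).
  - intros t Ht. auto_derive; [lra|]. field. lra.
  - intros t Ht. apply (ex_derive_continuous (V := R_NormedModule)).
    auto_derive. easy.
  - intros eps He. exists eps; split; auto. intros t Ht.
    pose proof (exp_ineq1_le (- (c * t))) as H1.
    assert (H2 : exp (- (c * t)) <= 1) by (apply exp_le_1; nra).
    replace (- (exp (- (c * t)) / c) - - / c) with ((1 - exp (- (c * t))) * / c)
      by (field; lra).
    rewrite Rabs_pos_eq by (apply Rmult_le_pos; lra).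
    apply Rmult_lt_reg_r with c; auto.
    rewrite Rmult_assoc, Rinv_l by lra. nra.
  (* From [exp (c * t) >= 1 + c * t], the antiderivative is at most 1/(c^2 t) in absolute value. *)
  - intros eps He. exists (/ (c * c * eps)); split.
    { apply Rinv_0_lt_compat. repeat apply Rmult_lt_0_compat; auto. }
    intros t Ht.
    assert (Ht0 : 0 < t).
    { apply Rlt_trans with (2 := Ht), Rinv_0_lt_compat.
      repeat apply Rmult_lt_0_compat; auto. }
    pose proof (exp_pos (- (c * t))) as Hp.
    replace (- (exp (- (c * t)) / c) - 0) with (- (exp (- (c * t)) * / c))
      by (unfold Rdiv; ring).
    rewrite Rabs_Ropp, Rabs_pos_eq by (apply Rmult_le_pos; lra).
    apply Rmult_lt_reg_r with (c * exp (c * t));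
      [apply Rmult_lt_0_compat; [auto|apply exp_pos]|].
    replace (exp (- (c * t)) * / c * (c * exp (c * t))) with 1.
    2: { rewrite exp_Ropp. pose proof (exp_pos (c * t)). field. lra. }
    pose proof (exp_ineq1_le (c * t)) as H1.
    apply (Rmult_lt_compat_l (c * c * eps)) in Ht.
    2: { repeat apply Rmult_lt_0_compat; auto. }
    rewrite Rinv_r in Ht.
    2: { apply Rgt_not_eq. repeat apply Rmult_lt_0_compat; auto. }
    apply Rlt_le_trans with (1 := Ht).
    replace (c * c * eps * t) with (eps * (c * (c * t))) by ring.
    apply Rmult_le_compat_l; [lra|]. apply Rmult_le_compat_l; lra.
Qed.

Lemma is_Int_pos_exp_pow (c : R) (k : nat) : 0 < c ->
  is_Int_pos (fun t => exp (- (c * t)) * t ^ k) (INR (fact k) / c ^ S k).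
Proof.
  intros Hc.
  apply is_Int_pos_ext with (fun t => exp (- (c * t)) * Rpower t (INR k)).
  { intros t Ht. now rewrite Rpower_pow. }
  induction k as [|k IH].
  - replace (INR (fact 0) / c ^ 1) with (/ c) by (simpl; field; lra).
    apply is_Int_pos_ext with (2 := is_Int_pos_exp c Hc).
    intros t Ht. simpl. rewrite Rpower_O by auto. ring.
  - replace (INR (fact (S k)) / c ^ S (S k))
      with (INR (S k) / c * (INR (fact k) / c ^ S k)).
    + apply is_Int_pos_exp_Rpower_succ; auto; [apply lt_0_INR; lia|].
      rewrite S_INR. replace (INR k + 1 - 1) with (INR k) by ring. exact IH.
    + rewrite fact_S_INR, S_INR. simpl. field. split; [now apply pow_nonzero, Rgt_not_eq|lra].
Qed.

Lemma Gamma_nat (n : nat) : Gamma (INR n + 1) = INR (fact n).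
Proof.
  apply is_Int_pos_unique with (f := fun t => exp (- t) * Rpower t (INR n)).
  - apply Gamma_is_Int_pos'. pose proof (pos_INR n). lra.
  - replace (INR (fact n)) with (INR (fact n) / 1 ^ S n) by (rewrite pow1; field).
    apply is_Int_pos_ext with (2 := is_Int_pos_exp_pow 1 n Rlt_0_1).
    intros t Ht. now rewrite Rmult_1_l, Rpower_pow.
Qed.

Lemma gbinom_nat (n k : nat) : (k <= n)%nat ->
  gbinom (INR n) (n - k) = Binomial.C n k.
Proof.
  intros Hk.
  assert (H : forall j, (j <= n)%nat ->
    falling (INR n) j * INR (fact (n - j)) = INR (fact n)).
  { induction j as [|j IH]; intros Hj.
    - rewrite Nat.sub_0_r. simpl. ring.
    - rewrite <- IH by lia. simpl falling.
      replace (n - j)%nat with (S (n - S j)) by lia.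
      rewrite fact_S_INR, minus_INR, S_INR by lia. ring. }
  specialize (H (n - k)%nat ltac:(lia)).
  replace (n - (n - k))%nat with k in H by lia.
  unfold gbinom, Binomial.C. rewrite <- H.
  pose proof (INR_fact_neq_0 k). pose proof (INR_fact_neq_0 (n - k)). field. auto.
Qed.

(** The Laplace transform of the Laguerre polynomial: integrated termwise, it is the binomial
    expansion of (1 - 1/c)^n, divided by c. *)
Lemma is_Int_pos_exp_Laguerre (c : R) (n : nat) : 0 < c ->
  is_Int_pos (fun t => exp (- (c * t)) * Laguerre n 0 t) ((1 - / c) ^ n / c).
Proof.
  intros Hc.
  replace ((1 - / c) ^ n / c) with (sum_f_R0 (fun k =>
    (-1) ^ k * gbinom (INR n + 0) (n - k) / INR (fact k)
    * (INR (fact k) / c ^ S k)) n).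
  - apply is_Int_pos_ext with (fun t => sum_f_R0 (fun k =>
      (-1) ^ k * gbinom (INR n + 0) (n - k) / INR (fact k)
      * (exp (- (c * t)) * t ^ k)) n).
    + intros t Ht. unfold Laguerre. rewrite scal_sum. apply sum_eq.
      intros k _. unfold Rdiv; ring.
    + apply (is_Int_pos_sum (fun k t => _)). intros k _.
      apply is_Int_pos_scal. now apply is_Int_pos_exp_pow.
  - replace (1 - / c) with (- / c + 1) by ring. rewrite binomial.
    unfold Rdiv at 3. rewrite Rmult_comm, scal_sum. apply sum_eq. intros k Hk.
    rewrite Rplus_0_r, gbinom_nat, pow1 by auto.
    replace (- / c) with (-1 * / c) by ring. rewrite Rpow_mult_distr, pow_inv.
    simpl. pose proof (INR_fact_neq_0 k). field.
    repeat split; auto; [now apply Rgt_not_eq|now apply pow_nonzero, Rgt_not_eq].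
Qed.

(** Taking e^(-t/2) out of e^(-at) leaves e^(-(a-1/2)t), expanded here for the weight e^-t. Its
    squared norm is 1/(2a) even when it grows, and the squared coefficients form a geometric series
    of ratio z^2 with 1 - z^2 = 2a/c^2. *)
Lemma is_Int_pos_exp_remainder (a : R) (N : nat) : 0 < a ->
  is_Int_pos (fun t => exp (- t) * (exp (- ((a - / 2) * t)) - sum_f_R0 (fun k =>
      (1 - / (a + / 2)) ^ k / (a + / 2) / 1 * Laguerre k 0 t) N) ^ 2)
    (((1 - / (a + / 2)) ^ 2) ^ S N / (2 * a)).
Proof.
  intros Ha. set (c := a + / 2). set (z := 1 - / c).
  assert (Hc : 0 < c) by (unfold c; lra).
  replace ((z ^ 2) ^ S N / (2 * a))
    with (/ (2 * a) - sum_f_R0 (fun k => (z ^ k / c) ^ 2 / 1) N).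
  2: { assert (Ec : 2 * a = 2 * c - 1) by (unfold c; lra). rewrite Ec.
       assert (2 * c - 1 <> 0) by lra.
       induction N as [|N IH].
       - simpl. unfold z. field. lra.
       - rewrite tech5, Rminus_plus_distr, IH.
         rewrite <- !pow_mult. replace (2 * S N)%nat with (S N + S N)%nat by lia.
         replace (2 * S (S N))%nat with (S N + S N + 2)%nat by lia.
         rewrite !pow_add.
         replace (z ^ 2) with (1 - (2 * c - 1) / c ^ 2) by (unfold z; field; lra).
         set (y := z ^ S N). field. lra. }
  assert (W : forall t, 0 < t -> exp (- t) = exp (- t) * Rpower t 0).
  { intros t Ht. rewrite Rpower_O by auto. ring. }
  apply (is_Int_pos_orth_remainder (fun t => exp (- t))
    (fun t => exp (- ((a - / 2) * t))) (fun k => Laguerre k 0)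
    (fun k => z ^ k / c) (fun _ => 1)).
  - intros _. lra.
  - intros m n Hmn.
    apply is_Int_pos_ext with (2 := is_Int_pos_Laguerre_orth 0 m n ltac:(lra) Hmn).
    intros t Ht. now rewrite <- W.
  - intros n.
    assert (H := is_Int_pos_Laguerre_norm 0 n ltac:(lra)).
    rewrite Rplus_0_r, Gamma_nat in H. unfold Rdiv in H.
    rewrite Rinv_r in H by apply INR_fact_neq_0.
    apply is_Int_pos_ext with (2 := H). intros t Ht. now rewrite <- W.
  - intros n.
    apply is_Int_pos_ext with (2 := is_Int_pos_exp_Laguerre c n Hc).
    intros t Ht. rewrite <- Rmult_assoc, <- exp_plus. do 2 f_equal. unfold c. field.
  - apply is_Int_pos_ext with (2 := is_Int_pos_exp (2 * a) ltac:(lra)).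
    intros t Ht. rewrite <- !exp_plus. f_equal. field.
Qed.

(** * Polynomial growth of the L1 norms of the Laguerre functions *)

Lemma is_Int_pos_Laguerre_norm_nat (j n : nat) :
  is_Int_pos (fun t => exp (- t) * t ^ j * Laguerre n (INR j) t ^ 2)
    (INR (fact (n + j)) / INR (fact n)).
Proof.
  pose proof (pos_INR j).
  assert (H1 := is_Int_pos_Laguerre_norm (INR j) n ltac:(lra)).
  rewrite <- plus_INR, Gamma_nat in H1.
  apply is_Int_pos_ext with (2 := H1). intros t Ht.
  rewrite Rpower_pow by auto. ring.
Qed.

Lemma is_Int_pos_Laguerre_2_norm (n : nat) :
  is_Int_pos (fun t => exp (- t) * t ^ 2 * Laguerre n 2 t ^ 2)
    ((INR n + 1) * (INR n + 2)).
Proof.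
  replace ((INR n + 1) * (INR n + 2)) with (INR (fact (n + 2)) / INR (fact n)).
  - exact (is_Int_pos_Laguerre_norm_nat 2 n).
  - replace (n + 2)%nat with (S (S n)) by lia. rewrite !fact_S_INR, S_INR.
    field. apply INR_fact_neq_0.
Qed.

Lemma Laguerre_0_second_difference (n : nat) (t : R) :
  Laguerre (S (S n)) 0 t = Laguerre (S (S n)) 2 t - 2 * Laguerre (S n) 2 t + Laguerre n 2 t.
Proof.
  rewrite (Laguerre_pascal 0), (Laguerre_pascal (0 + 1) t (S n)),
    (Laguerre_pascal (0 + 1) t n).
  replace (0 + 1 + 1) with 2 by ring. ring.
Qed.

(* Comparing L^(0) with L^(2) gives the second moment of the square of L^(0)
   from the orthogonality relations alone. *)
Lemma Laguerre_0_second_moment (n : nat) : exists q v,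
  is_Int_pos q v /\ v <= 16 * ((INR n + 1) * (INR n + 2)) /\
  forall t, 0 < t -> exp (- t) * t ^ 2 * Laguerre n 0 t ^ 2 <= q t.
Proof.
  assert (W : forall t, 0 < t -> 0 < exp (- t) * t ^ 2).
  { intros t Ht. apply Rmult_lt_0_compat; [apply exp_pos|now apply pow_lt]. }
  destruct n as [|[|n]].
  - eexists _, _; split; [apply (is_Int_pos_Laguerre_2_norm 0)|]. split.
    + simpl; lra.
    + intros t Ht. rewrite !Laguerre_0. lra.
  - eexists _, _; split; [apply (is_Int_pos_plus _ _ _ _
      (is_Int_pos_scal _ 2 _ (is_Int_pos_Laguerre_2_norm 1))
      (is_Int_pos_scal _ 8 _ (is_Int_pos_Laguerre_2_norm 0)))|]. split.
    + simpl; lra.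
    + intros t Ht. specialize (W t Ht). cbv beta.
      replace (Laguerre 1 0 t) with (Laguerre 1 2 t - 2 * Laguerre 0 2 t).
      2: { rewrite (Laguerre_pascal 0), (Laguerre_pascal (0 + 1)), !Laguerre_0.
           replace (0 + 1 + 1) with 2 by ring. ring. }
      pose proof (pow2_ge_0 (Laguerre 1 2 t + 2 * Laguerre 0 2 t)).
      set (A := Laguerre 1 2 t) in *. set (B := Laguerre 0 2 t) in *.
      replace (2 * (exp (- t) * t ^ 2 * A ^ 2) + 8 * (exp (- t) * t ^ 2 * B ^ 2))
        with (exp (- t) * t ^ 2 * (2 * A ^ 2 + 8 * B ^ 2)) by ring.
      apply Rmult_le_compat_l; nra.
  (* The weights 4, 8, 4 come from (A - 2B + D)^2 <= (1 + 2 + 1)(A^2 + 2B^2 + D^2). *)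
  - eexists _, _; split; [apply (is_Int_pos_plus _ _ _ _
      (is_Int_pos_scal _ 4 _ (is_Int_pos_Laguerre_2_norm (S (S n))))
      (is_Int_pos_plus _ _ _ _
      (is_Int_pos_scal _ 8 _ (is_Int_pos_Laguerre_2_norm (S n)))
      (is_Int_pos_scal _ 4 _ (is_Int_pos_Laguerre_2_norm n))))|]. split.
    + rewrite !S_INR. pose proof (pos_INR n). nra.
    + intros t Ht. specialize (W t Ht). cbv beta.
      rewrite Laguerre_0_second_difference.
      set (A := Laguerre (S (S n)) 2 t). set (B := Laguerre (S n) 2 t).
      set (D := Laguerre n 2 t).
      replace (4 * (exp (- t) * t ^ 2 * A ^ 2) + (8 * (exp (- t) * t ^ 2 * B ^ 2)
        + 4 * (exp (- t) * t ^ 2 * D ^ 2)))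
        with (exp (- t) * t ^ 2 * (4 * A ^ 2 + 8 * B ^ 2 + 4 * D ^ 2)) by ring.
      apply Rmult_le_compat_l; [lra|].
      pose proof (pow2_ge_0 (A + B)). pose proof (pow2_ge_0 (B + D)).
      pose proof (pow2_ge_0 (A - D)). nra.
Qed.

Lemma continuous_scrL0 (n : nat) (t : R) : continuous (scrL0 n) t.
Proof.
  apply continuous_Rmult; [|apply continuous_Laguerre].
  apply (ex_derive_continuous (V := R_NormedModule)). auto_derive. easy.
Qed.

Lemma exp_half_sq (t : R) : exp (- t / 2) ^ 2 = exp (- t).
Proof. simpl. rewrite Rmult_1_r, <- exp_plus. f_equal. field. Qed.

(** Young's bound with d = 1/(1+t)^2, whose integral is the beta kernel for s = 1. Since (1+t)^2 <=
    2(1+t^2), the quadratic term is controlled by the moments of order 0 and 2. *)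
Lemma scrL0_norm (n : nat) (a b : R) : 0 < a -> a <= b ->
  RInt (fun t => Rabs (scrL0 n t)) a b <= 18 * ((INR n + 1) * (INR n + 2)).
Proof.
  intros Ha Hab. destruct (Laguerre_0_second_moment n) as (q & v & Hq & Hv & Hle).
  assert (H0 := is_Int_pos_Laguerre_norm_nat 0 n).
  rewrite Nat.add_0_r in H0. unfold Rdiv in H0.
  rewrite Rinv_r in H0 by apply INR_fact_neq_0.
  assert (HI := is_Int_pos_plus _ _ _ _
    (is_Int_pos_scal _ (/ 2) _ (is_Int_pos_beta_kernel 1 Rlt_0_1))
    (is_Int_pos_plus _ _ _ _ H0 Hq)).
  eapply Rle_trans; [eapply RInt_abs_le_Int_pos with (2 := HI)|]; auto.
  - intros t _. apply continuous_scrL0.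
  - intros t Ht. specialize (Hle t Ht). cbv beta.
    rewrite Rmult_1_l. unfold Rminus. rewrite exp_plus, exp_Ropp, !exp_ln by lra.
    change (INR 0) with 0. simpl (t ^ 0). rewrite Rmult_1_r.
    unfold scrL0. set (g := exp (- t / 2) * Laguerre n 0 t).
    assert (Eg : g ^ 2 = exp (- t) * Laguerre n 0 t ^ 2).
    { unfold g. now rewrite Rpow_mult_distr, exp_half_sq. }
    assert (Hd : 0 < / (1 + t) ^ 2) by (apply Rinv_0_lt_compat, pow_lt; lra).
    pose proof (Rabs_le_young g _ Hd) as Y. rewrite Rinv_inv in Y.
    replace (/ 2 * (t * / (1 + t) * (1 / (t * (1 + t))))) with (/ 2 * / (1 + t) ^ 2)
      by (field; lra).
    rewrite <- Eg.
    replace (exp (- t) * t ^ 2 * Laguerre n 0 t ^ 2) with (t ^ 2 * g ^ 2) in Hle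
      by (rewrite Eg; ring).
    assert (0 <= (1 - t) ^ 2 * g ^ 2) by (apply Rmult_le_pos; apply pow2_ge_0).
    nra.
  - pose proof (pos_INR n). nra.
Qed.

Lemma ex_series_poly_geom (x : R) : 0 < x < 1 ->
  ex_series (fun n => (INR n + 1) * (INR n + 2) * x ^ n).
Proof.
  intros Hx.
  assert (P : forall n, 0 < (INR n + 1) * (INR n + 2) * x ^ n).
  { intros n. pose proof (pos_INR n).
    apply Rmult_lt_0_compat; [apply Rmult_lt_0_compat; lra|apply pow_lt; lra]. }
  apply ex_series_ext with (fun n => Rabs ((INR n + 1) * (INR n + 2) * x ^ n)).
  { intros n. apply Rabs_pos_eq, Rlt_le, P. }
  apply ex_series_DAlembert with x; [lra|intros n; apply Rgt_not_eq, P|].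
  (* The ratio of consecutive terms is x (n+3)/(n+1). *)
  apply is_lim_seq_ext with (fun n => x + 2 * x * / (INR n + 1)).
  - intros n. rewrite Rabs_pos_eq.
    + rewrite S_INR. simpl. pose proof (pos_INR n). field.
      repeat split; try lra. apply pow_nonzero; lra.
    + apply Rlt_le, Rdiv_lt_0_compat; apply P.
  - replace (Finite x) with (Finite (x + 2 * x * 0)) by (f_equal; ring).
    apply is_lim_seq_plus'; [apply is_lim_seq_const|].
    apply is_lim_seq_mult'; [apply is_lim_seq_const|].
    apply is_lim_seq_ext with (fun n => / INR (S n)).
    { intros n. now rewrite S_INR. }
    apply (is_lim_seq_incr_1 (fun n => / INR n)).
    replace (Finite 0) with (Rbar_inv p_infty) by easy.
    apply is_lim_seq_inv; [apply is_lim_seq_INR|easy].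
Qed.

Lemma ex_series_tail_small (u : nat -> R) (eps : R) :
  (forall n, 0 <= u n) -> ex_series u -> 0 < eps ->
  exists N, forall n M, (N <= n <= M)%nat -> sum_f_R0 u M - sum_f_R0 u n <= eps.
Proof.
  intros Hu [l Hl] He.
  assert (L : is_lim_seq (sum_f_R0 u) l).
  { apply is_lim_seq_ext with (sum_n u); [intros n; apply sum_n_Reals|exact Hl]. }
  assert (Hub := is_lim_seq_incr_compare _ _ L
    ltac:(intros n; rewrite tech5; specialize (Hu (S n)); lra)).
  apply is_lim_seq_spec in L. destruct (L (mkposreal eps He)) as [N HN].
  exists N. intros n M [Hn _]. specialize (HN n Hn). simpl in HN.
  apply Rabs_def2 in HN. specialize (Hub M). lra.
Qed.

(* On a fixed [a,b] the L2 convergence identifies the sum of the absolutely convergent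
   series, and the bounds [u k] do not depend on [a,b]. *)
Lemma L1_series_converges_of_L2 (f : R -> R) (g : nat -> R -> R) (u E : nat -> R) :
  (forall t, 0 < t -> continuous f t) ->
  (forall k t, 0 < t -> continuous (g k) t) ->
  (forall k a b, 0 < a -> a <= b -> RInt (fun t => Rabs (g k t)) a b <= u k) ->
  ex_series u ->
  (forall n, is_Int_pos (fun t => (f t - sum_f_R0 (fun k => g k t) n) ^ 2) (E n)) ->
  is_lim_seq E 0 ->
  L1_series_converges f g.
Proof.
  intros Hf Hg Hu Su HE LE.
  assert (cr : forall n t, 0 < t ->
    continuous (fun t => f t - sum_f_R0 (fun k => g k t) n) t).
  { intros n t Ht. apply continuous_Rminus; [auto|].
    apply (continuous_sum_f_R0 g). auto. }
  assert (car : forall n t, 0 < t ->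
    continuous (fun t => Rabs (f t - sum_f_R0 (fun k => g k t) n)) t).
  { intros n t Ht.
    apply (continuous_Rabs_comp (fun t => f t - sum_f_R0 (fun k => g k t) n)). auto. }
  assert (cag : forall k t, 0 < t -> continuous (fun t => Rabs (g k t)) t).
  { intros k t Ht. apply (continuous_Rabs_comp (g k)). auto. }
  assert (Hu0 : forall k, 0 <= u k).
  { intros k. apply Rle_trans with (2 := Hu k 1 1 Rlt_0_1 (Rle_refl 1)).
    rewrite RInt_point. apply Rle_refl. }
  apply L1_series_converges_intro; auto. intros eps He.
  destruct (ex_series_tail_small u (eps / 2) Hu0 Su) as [N HN]; [lra|].
  exists N. intros n Hn a b Ha Hab.
  (* The remainder at [n] exceeds the one at a later [M] by at most a tail of the series of [u],
     which is small uniformly in [a] and [b]. Only [M] will depend on the interval. *)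
  assert (Tel : forall M, (n <= M)%nat ->
    RInt (fun t => Rabs (f t - sum_f_R0 (fun k => g k t) n)) a b
    <= RInt (fun t => Rabs (f t - sum_f_R0 (fun k => g k t) M)) a b
       + (sum_f_R0 u M - sum_f_R0 u n)).
  { intros M HM. induction HM as [|M HM IH]; [lra|].
    apply Rle_trans with (1 := IH). rewrite tech5.
    specialize (Hu (S M) a b Ha Hab).
    pose proof (RInt_plus (V := R_CompleteNormedModule) _ _ a b
      (ex_RInt_pos _ a b (car (S M)) Ha ltac:(lra))
      (ex_RInt_pos _ a b (cag (S M)) Ha ltac:(lra))) as Ep.
    unfold plus in Ep; simpl in Ep.
    assert (Hle : RInt (fun t => Rabs (f t - sum_f_R0 (fun k => g k t) M)) a b
      <= RInt (fun t => Rabs (f t - sum_f_R0 (fun k => g k t) (S M))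
                        + Rabs (g (S M) t)) a b).
    { apply RInt_le; auto.
      - apply ex_RInt_pos; auto; lra.
      - apply ex_RInt_pos; [|lra|lra]. intros t Ht.
        apply (continuous_plus (V := R_NormedModule)); [now apply car|now apply cag].
      - intros t Ht. rewrite tech5.
        eapply Rle_trans; [|apply Rabs_triang]. right. f_equal. ring. }
    simpl in Hle. simpl. lra. }
  (* Young's bound on the interval: the constant part gives at most [eps / 4], and so does the
     quadratic part once [E M < d * (eps / 2)]. The added 1 covers [a = b]. *)
  set (d := eps / 2 / (b - a + 1)).
  assert (Hd : 0 < d) by (apply Rdiv_lt_0_compat; lra).
  assert (Hed : 0 < d * (eps / 2)) by (apply Rmult_lt_0_compat; lra).
  apply is_lim_seq_spec in LE. destruct (LE (mkposreal _ Hed)) as [M0 HM0].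
  set (M := Nat.max n M0).
  specialize (HM0 M ltac:(unfold M; lia)). simpl in HM0.
  rewrite Rminus_0_r in HM0. apply Rabs_def2 in HM0.
  specialize (Tel M ltac:(unfold M; lia)).
  specialize (HN n M ltac:(unfold M; lia)).
  enough (RInt (fun t => Rabs (f t - sum_f_R0 (fun k => g k t) M)) a b <= eps / 2)
    by lra.
  pose proof (HE M) as [cS _].
  assert (HS := RInt_le_Int_pos _ _ a b (HE M) ltac:(intros; apply pow2_ge_0) Ha Hab).
  set (s := fun t => (f t - sum_f_R0 (fun k => g k t) M) ^ 2) in *.
  assert (xs : ex_RInt s a b) by (apply ex_RInt_pos; auto; lra).
  apply Rle_trans with (RInt (fun t => plus (/ 2 * d) (scal (/ 2 * / d) (s t))) a b).
  - apply RInt_le; auto.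
    + apply ex_RInt_pos; auto; lra.
    + apply (ex_RInt_plus (V := R_CompleteNormedModule) (fun _ => / 2 * d)
        (fun t => scal (/ 2 * / d) (s t)));
        [apply ex_RInt_const|].
      now apply (ex_RInt_scal (V := R_CompleteNormedModule) s).
    + intros t Ht. eapply Rle_trans; [apply (Rabs_le_young _ d Hd)|].
      right. unfold plus, scal, s; simpl; unfold mult; simpl. ring.
  - rewrite (RInt_plus (V := R_CompleteNormedModule) (fun _ => / 2 * d)
      (fun t => scal (/ 2 * / d) (s t)));
      [|apply ex_RInt_const|now apply (ex_RInt_scal (V := R_CompleteNormedModule) s)].
    rewrite (RInt_scal (V := R_CompleteNormedModule) s) by auto.
    rewrite (RInt_const (V := R_CompleteNormedModule)).
    unfold plus, scal; simpl; unfold mult; simpl.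
    assert (H1 : (b - a) * d <= eps / 2).
    { replace (eps / 2) with ((b - a + 1) * d) by (unfold d; field; lra).
      apply Rmult_le_compat_r; lra. }
    assert (H2 : / d * RInt s a b <= eps / 2).
    { replace (eps / 2) with (/ d * (d * (eps / 2))) by (field; lra).
      apply Rmult_le_compat_l; [left; now apply Rinv_0_lt_compat|lra]. }
    lra.
Qed.

Lemma exp_expansion (a : R) : 0 < a ->
  L1_series_converges (fun t => exp (- (a * t)))
    (fun n t => (a - 1 / 2) ^ n / (a + 1 / 2) ^ (n + 1) * scrL0 n t).
Proof.
  intros Ha. set (c := a + / 2). set (z := 1 - / c).
  assert (Hc : 0 < c) by (unfold c; lra).
  pose proof (Rinv_0_lt_compat c Hc) as Hic.
  (* Here z = (a - 1/2)/(a + 1/2); its absolute value is below 1 because c > 1/2. *)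
  assert (Hz : Rabs z < 1).
  { apply Rabs_def1; [unfold z; lra|].
    unfold z. assert (/ c < 2); [|lra].
    replace 2 with (/ / 2) by field. apply Rinv_lt_contravar; [|unfold c; lra].
    apply Rmult_lt_0_compat; lra. }
  assert (Ed : forall n, (a - 1 / 2) ^ n / (a + 1 / 2) ^ (n + 1) = z ^ n / c).
  { intros n. replace (a + 1 / 2) with c by (unfold c; field).
    replace (a - 1 / 2) with (z * c) by (unfold z, c; field; lra).
    rewrite Rpow_mult_distr, pow_add. simpl. field. split; [lra|].
    apply pow_nonzero; lra. }
  (* A majorant of [Rabs z] that stays positive at a = 1/2, where z = 0 and the ratio test would
     divide by zero. *)
  set (x := (1 + Rabs z) / 2). pose proof (Rabs_pos z) as Hz0.
  assert (Hx : 0 < x < 1) by (unfold x; lra).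
  assert (cg : forall k t, 0 < t -> continuous (fun t =>
    (a - 1 / 2) ^ k / (a + 1 / 2) ^ (k + 1) * scrL0 k t) t).
  { intros k t _. apply continuous_Rmult; [apply continuous_const|].
    apply continuous_scrL0. }
  apply L1_series_converges_of_L2 with
    (u := fun n => scal (18 * / c) ((INR n + 1) * (INR n + 2) * x ^ n))
    (E := fun n => (z ^ 2) ^ S n / (2 * a)); auto.
  - intros t _. apply (ex_derive_continuous (V := R_NormedModule)). auto_derive. easy.
  - intros k p q Hp Hpq. rewrite Ed.
    rewrite (RInt_ext _ (fun t => scal (Rabs z ^ k * / c) (Rabs (scrL0 k t)))).
    2: { intros t _. unfold scal; simpl; unfold mult; simpl.
         rewrite Rabs_mult. f_equal. unfold Rdiv. rewrite Rabs_mult, <- RPow_abs.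
         f_equal. apply Rabs_pos_eq. lra. }
    rewrite (RInt_scal (V := R_CompleteNormedModule)).
    2: { apply ex_RInt_pos; [|lra|lra]. intros t Ht.
         apply (continuous_Rabs_comp (scrL0 k)), continuous_scrL0. }
    unfold scal; simpl; unfold mult; simpl.
    pose proof (scrL0_norm k p q Hp Hpq). pose proof (pos_INR k).
    assert (0 <= Rabs z ^ k <= x ^ k).
    { split; [now apply pow_le|]. apply pow_incr. unfold x. lra. }
    apply Rle_trans with (Rabs z ^ k * / c * (18 * ((INR k + 1) * (INR k + 2)))).
    + apply Rmult_le_compat_l; [apply Rmult_le_pos; lra|auto].
    + replace (18 * / c * ((INR k + 1) * (INR k + 2) * x ^ k))
        with (x ^ k * / c * (18 * ((INR k + 1) * (INR k + 2)))) by ring.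
      apply Rmult_le_compat_r; [nra|]. apply Rmult_le_compat_r; lra.
  - apply (ex_series_scal (V := R_NormedModule)). now apply ex_series_poly_geom.
  - intros n. apply is_Int_pos_ext with (2 := is_Int_pos_exp_remainder a n Ha).
    (* The factor [exp (- t / 2)] common to [scrL0] and the exponential turns, once squared, into
       the weight. *)
    intros t _. rewrite <- exp_half_sq, <- Rpow_mult_distr. f_equal.
    rewrite Rmult_minus_distr_l, <- exp_plus. f_equal; [f_equal; field|].
    rewrite scal_sum. apply sum_eq. intros k _. rewrite Ed. fold c z.
    unfold scrL0. field. lra.
  - apply is_lim_seq_ext with (fun n => (z ^ 2) ^ n * (z ^ 2 / (2 * a))).
    { intros n. simpl. field. lra. }
    replace (Finite 0) with (Finite (0 * (z ^ 2 / (2 * a)))) by (f_equal; ring).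
    apply is_lim_seq_mult'; [|apply is_lim_seq_const].
    apply is_lim_seq_geom. rewrite <- RPow_abs. simpl. nra.
Qed.

Theorem theorem3p2 :
  (forall alpha beta : R, -1 < alpha -> alpha < 2 * beta ->
     L1_series_converges (I_ (beta + 1))
       (fun n t => gbinom (alpha - beta + INR n - 1) n * ell n alpha t))
  /\ (forall alpha : R, alpha > 2 ->
     L1_series_converges (I_ alpha) (fun n t => ell n alpha t))
  /\ (forall a : R, a > 0 ->
     L1_series_converges (fun t => exp (- (a * t)))
       (fun n t => (a - 1 / 2) ^ n / (a + 1 / 2) ^ (n + 1) * scrL0 n t)).
Proof.
  split; [|split].
  - intros alpha beta Ha Hb. apply I_expansion; lra.
  - intros alpha Ha.
    (* For beta = alpha - 1 the coefficients are [gbinom (INR n) n], all equal to 1. *)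
    replace (fun n t => ell n alpha t) with
      (fun n t => gbinom (alpha - (alpha - 1) + INR n - 1) n * ell n alpha t).
    + replace alpha with (alpha - 1 + 1) at 1 by ring. apply I_expansion; lra.
    + extensionality n. extensionality t.
      replace (alpha - (alpha - 1) + INR n - 1) with (INR n) by ring.
      rewrite gbinom_diag. ring.
  - intros a Ha. now apply exp_expansion.
Qed.
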